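(* Let $\mathcal{A}=\{a_0,a_1,\dots,a_{n+1}\}\subset\mathbb{R}^n$ be a set of codimension $1$ and dimension $n$ (that is, $n+2$ points not contained in an affine hyperplane). Let $C$ be a complex matrix of size $n\times(n+2)$ of maximal rank $n$. Then the system $C\cdot x^A=0$ has $\mathbf{1}=(1,\dots,1)$ as a solution of multiplicity $n+1$ if and only if the kernel of $C$ contains the vector with all coordinates equal to $1$ and a vector with distinct coordinates $d_0,\dots,d_{n+1}$ such that $\mathcal{A}$ is equal to the cyclic point configuration $\{\gamma(d_0),\dots,\gamma(d_{n+1})\}$ up to an affine transformation of $\mathbb{R}^n$.
   Context: $\gamma:\mathbb{C}\to\mathbb{C}^n$ is the map $\gamma(t)=(t,t^2,\dots,t^n)$, and a cyclic point configuration is the image of a finite set by $\gamma$. Writing $C=(c_{ij})$ with $1\le i\le n$ and $0\le j\le n+1$, the system $C\cdot x^A=0$ is $\sum_{j=0}^{n+1}c_{ij}x^{a_j}=0$, $i=1,\dots,n$, in the variables $x=(x_1,\dots,x_n)$. For $a\in\mathbb{Z}^n$, $x^a$ is the usual Laurent monomial; for $a=(a^{(1)},\dots,a^{(n)})\in\mathbb{R}^n$, $x^a=\prod_{i=1}^n e^{a^{(i)}\log x_i}$ near $\mathbf{1}$, where $\log$ is the branch of the logarithm on $\mathbb{C}\setminus\mathbb{R}_{\le0}$ with $\log 1=0$. The multiplicity of the solution $\mathbf{1}$ is the local intersection multiplicity of the $n$ equations at the isolated solution $\mathbf{1}$, i.e. the complex dimension of the quotient of the local ring of convergent power series at $\mathbf{1}$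 by the ideal the equations generate.
   Formalization: The affine transformation is taken to be an invertible affine map of C^n (a real one need not exist when the d_j are not real; it does when they are), and A is matched with the cyclic configuration index by index, a_j with γ(d_j), not merely as sets. *)

(* Defs.v *)
From HB Require Import structures.
From mathcomp Require Import all_boot all_order all_algebra.
From mathcomp Require Import complex.
From mathcomp Require Import all_classical all_reals all_analysis.

Set Implicit Arguments.
Unset Strict Implicit.
Unset Printing Implicit Defensive.

Import Order.TTheory GRing.Theory Num.Theory.
Import numFieldNormedType.Exports.

Local Open Scope classical_set_scope.
Local Open Scope complex_scope.
Local Open Scope ring_scope.

Section ComplexPowers.
Context {R : realType}.
Implicit Types z : R[i].

Definition cexp z : R[i] :=
  expR (complex.Re z) * cos (complex.Im z)
    +i* (expR (complex.Re z) * sin (complex.Im z)).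

Definition cmod z : R :=
  Num.sqrt (complex.Re z ^+ 2 + complex.Im z ^+ 2).

(* The principal branch on the complement of the nonpositive reals, by the
   half-angle formula tan (arg z / 2) = Im z / (|z| + Re z); the values on
   the nonpositive reals are junk. *)
Definition clog z : R[i] :=
  ln (cmod z)
    +i* (2 * atan (complex.Im z / (cmod z + complex.Re z))).

Lemma clog1 : clog 1 = 0.
Proof.
by rewrite /clog /cmod /= expr1n expr0n addr0 sqrtr1 ln1 mul0r atan0 mulr0.
Qed.

Definition monomial n (a : 'cV[R]_n) (x : 'cV[R[i]]_n) : R[i] :=
  \prod_(i < n) cexp ((a i 0)%:C * clog (x i 0)).

Definition sparse_system n k (C : 'M[R[i]]_(n, k)) (a : 'I_k -> 'cV[R]_n)
    (i : 'I_n) (x : 'cV[R[i]]_n) : R[i] :=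
  \sum_(j < k) C i j * monomial (a j) x.

End ComplexPowers.

Section Multiplicity.
Context {R : realType} {n : nat}.

Definition mindex := {ffun 'I_n -> nat}.

Definition pseries := mindex -> R[i].

Definition box N (k : {ffun 'I_n -> 'I_N}) : mindex := [ffun i => val (k i)].

Definition psum (c : pseries) (y : 'cV[R[i]]_n) (N : nat) : R[i] :=
  \sum_(k : {ffun 'I_n -> 'I_N}) c (box k) * \prod_(i < n) y i 0 ^+ k i.

(* Absolute convergence on some closed polydisc of positive radius. *)
Definition convergent (c : pseries) : Prop :=
  exists r M : R, 0 < r /\
    forall N, psum (fun k => `|c k|) (const_mx r%:C) N <= M%:C.

Definition expands (p : 'cV[R[i]]_n) (f : 'cV[R[i]]_n -> R[i]) (c : pseries) :
    Prop :=
  convergent c /\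
  exists2 r : R, 0 < r &
    forall y : 'cV[R[i]]_n, (forall i, `|y i 0| < r%:C) ->
      (psum c y N : R[i]^o) @[N --> \oo] --> (f (p + y) : R[i]^o).

(* Cauchy product: the coefficient of index k sums over all l <= k. *)
Definition pmul (f g : pseries) : pseries := fun k =>
  \sum_(l : {ffun 'I_n -> 'I_(\sum_(i < n) k i).+1} | [forall i, l i <= k i]%N)
    f (box l) * g [ffun i => (k i - l i)%N].

Definition in_ideal s (F : 'I_s -> pseries) (h : pseries) : Prop :=
  exists g : 'I_s -> pseries, (forall i, convergent (g i)) /\
    forall k, h k = \sum_(i < s) pmul (g i) (F i) k.

(* The classes of e_0, ..., e_(m-1) form a basis of the quotient of the local
   ring of convergent power series by the ideal generated by the F_i. *)
Definition quotient_dim s (F : 'I_s -> pseries) (m : nat) : Prop :=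
  exists e : 'I_m -> pseries, (forall j, convergent (e j)) /\
    forall h, convergent h ->
      exists! u : 'rV[R[i]]_m,
        in_ideal F (fun k => h k - \sum_(j < m) u 0 j * e j k).

Definition solution_of_multiplicity s (f : 'I_s -> 'cV[R[i]]_n -> R[i])
    (p : 'cV[R[i]]_n) (m : nat) : Prop :=
  (forall i, f i p = 0) /\
  exists F : 'I_s -> pseries,
    (forall i, expands p (f i) (F i)) /\ quotient_dim F m.

End Multiplicity.

Section Cyclic.
Context {R : realType}.

Definition in_hyperplane n k (a : 'I_k -> 'cV[R]_n) : Prop :=
  exists (u : 'rV[R]_n) (b : R), u != 0 /\ forall j, (u *m a j) 0 0 = b.

Definition gamma n (t : R[i]) : 'cV[R[i]]_n := \col_(i < n) t ^+ i.+1.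

(* The configurations are labelled: a_j corresponds to gamma (d_j).  As the
   d_j are complex, the affine transformation is an invertible affine map of
   C^n; whenever the d_j are real it can be taken to be a transformation of
   R^n (cyclic_up_to_affine_real).  A real one does not always exist: with
   w^2 + w + 1 = 0, the system x + y + 1/(xy) = 3, x + w y + w^2/(xy) = 0 has
   (1,1) as a solution of multiplicity 3 = n + 1 and corresponds to
   d = (0, 1, w, w^2), but its exponents (0,0), (1,0), (0,1), (-1,-1) are not
   in convex position, hence not a real affine image of points of a parabola. *)
Definition cyclic_up_to_affine n k (a : 'I_k -> 'cV[R]_n) (d : 'I_k -> R[i]) :
    Prop :=
  exists (M : 'M[R[i]]_n) (b : 'cV[R[i]]_n), M \in unitmx /\
    forall j, map_mx (real_complex R) (a j) = M *m gamma n (d j) + b.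

Lemma cyclic_up_to_affine_real n k (a : 'I_k -> 'cV[R]_n) (t : 'I_k -> R) :
  ~ in_hyperplane a -> cyclic_up_to_affine a (fun j => (t j)%:C) ->
  exists (M : 'M[R]_n) (b : 'cV[R]_n), M \in unitmx /\
    forall j, a j = M *m (\col_(i < n) t j ^+ i.+1) + b.
Proof.
move=> Ha [M [b [_ Hab]]].
pose reM := map_mx (@complex.Re R) M; pose reb := map_mx (@complex.Re R) b.
have Hre j : a j = reM *m (\col_(i < n) t j ^+ i.+1) + reb.
  apply/matrixP=> i l; move/matrixP: (Hab j) => /(_ i l).
  rewrite !mxE => /(congr1 (@complex.Re R)) /=.
  rewrite raddfD raddf_sum /= => ->; congr (_ + _).
  apply: eq_bigr => s _; rewrite !mxE -rmorphXn /=.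
  by case: (M i s) => x y /=; rewrite mulr0 subr0.
exists reM, reb; split=> //.
rewrite -row_free_unit -kermx_eq0; apply/negPn/negP => /rowV0Pn [u].
move=> /sub_kermxP uM u0; apply: Ha; exists u, ((u *m reb) 0 0); split=> // j.
by rewrite Hre mulmxDr mulmxA uM mul0mx add0r.
Qed.

End Cyclic.

(* Main.v *)
Require Import Defs.
From HB Require Import structures.
From mathcomp Require Import all_boot all_order all_algebra.
From mathcomp Require Import complex.
From mathcomp Require Import all_classical all_reals all_analysis.
From mathcomp Require Import ring lra.

Set Implicit Arguments.
Unset Strict Implicit.
Unset Printing Implicit Defensive.

Import Order.TTheory GRing.Theory Num.Theory.
Import numFieldNormedType.Exports.
Local Open Scope ring_scope.

(** Write K for the complex numbers R[i] and O for the ring of convergent power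
    series in y = x - 1.  At the point 1 the i-th equation expands as
    F_i = sum_j c_ij (1 + y)^(a_j), with binomial coefficients, so the theorem
    computes the dimension of O / (F_1, ..., F_n).  Call a vector
    (x_j) indexed by the exponents affine if x_j is an affine function of a_j,
    and write d^k for the vector (d_j^k).

    If the Jacobian matrix J of the F_i at the origin is invertible, the F_i
    generate the maximal ideal ([nakayama]), and the multiplicity is
    1 < n + 1.  Otherwise J v = 0 for some v <> 0, and d_j = <a_j, v> defines
    a non-constant affine vector d of the kernel of C.  On a curve x(t) with
    <a_j, log x(t)> = log u(t) + log (1 + t d_j) the i-th equation takes the
    value u(t) sum_j c_ij (1 + t d_j) = 0.  The coefficient of t^k in
    log (1 + t d_j) is a multiple of d_j^k that does not depend on j, so the
    curve exists modulo t^m as soon as d^k is affine for 0 < k < m; one order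
    further the i-th equation takes the value e (C d^m)_i t^m, with e <> 0
    ([curve_exists], [system_curve]).

    If m is the least exponent for which d^m is not affine, the multiplicity is
    m; if d^k is affine for all k <= n + 1, it is not n + 1.  Let w be a
    linear form in y with a non-zero derivative along the curve.  Pulling back
    along the curve shows that 1, w, ..., w^(m-1) are independent modulo the
    ideal as soon as d^k is affine for 0 < k < m ([indep_pow]).  If d^m is not
    affine, they span the quotient: the series
    F_i + e (C d^m)_i w have an invertible linear part, hence generate the
    maximal ideal, so modulo the F_i every series is a polynomial in w of
    degree less than m plus a multiple of w^m; and w^m belongs to the ideal
    ([pow_w_in]), by comparison with the order of vanishing along the curve of
    the combination of the F_i that has no linear part.

    Therefore the multiplicity is n + 1 exactly when d^0, ..., d^n are affine
    and d^(n+1) is not.  In this case the d_j are distinct, since otherwise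
    they are roots of a monic polynomial of degree n + 1 and d^(n+1) is a
    combination of lower powers; and gamma (d_j) is the image of a_j by an
    affine map, which is invertible because a non-zero polynomial of degree at
    most n cannot vanish at n + 2 points.  The same count of roots gives the
    converse.

    Two facts of analysis link this algebra with the given functions: the
    binomial series converges to the principal branch of the power
    ([binomial_series]), and a function has at most one expansion
    ([expands_unique]). *)

(** * Multi-indices and the Cauchy product *)

Section MultiIndex.
Variable n : nat.
Local Notation idx := (@mindex n).

(** The multi-indices with all entries below N, as a sequence: sums over two
    different boxes can then be compared inside one type. *)
Definition boxes N : seq idx :=
  [seq box k | k <- enum {: {ffun 'I_n -> 'I_N}}].

Definition deg (k : idx) : nat := \sum_(i < n) k i.

Lemma idxDE (k l : idx) i : (k + l)%R i = (k i + l i)%N.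
Proof. exact: ffunE. Qed.

Lemma degD (k l : idx) : deg (k + l)%R = (deg k + deg l)%N.
Proof. by rewrite /deg -big_split /=; apply: eq_bigr => i _; rewrite ffunE. Qed.

Lemma deg0 : deg 0 = 0%N.
Proof. by rewrite /deg big1 // => i _; rewrite ffunE. Qed.

Lemma leq_deg (k : idx) i : (k i <= deg k)%N.
Proof. by rewrite /deg (bigD1 i) //= leq_addr. Qed.

Lemma deg_eq0 (k : idx) : (deg k == 0%N) = (k == 0).
Proof.
apply/eqP/eqP => [k0|->]; last exact: deg0.
by apply/ffunP => i; rewrite !ffunE; apply/eqP; rewrite -leqn0 -k0 leq_deg.
Qed.

Lemma box_inj N : injective (@box n N).
Proof.
by move=> k l /ffunP kl; apply/ffunP => i; apply: val_inj; have := kl i; rewrite !ffunE.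
Qed.

Lemma boxes_uniq N : uniq (boxes N).
Proof. by rewrite map_inj_uniq ?enum_uniq //; exact: box_inj. Qed.

Lemma mem_boxes k N : (k \in boxes N) = [forall i, (k i < N)%N].
Proof.
apply/mapP/forallP => [[l _ ->] i|kN]; first by rewrite ffunE /=; case: (l i).
exists [ffun i => Ordinal (kN i)]; first by rewrite mem_enum.
by apply/ffunP => i; rewrite !ffunE.
Qed.

Lemma boxes_deg k N : (deg k < N)%N -> k \in boxes N.
Proof.
move=> kN; rewrite mem_boxes; apply/forallP => i.
by apply: leq_ltn_trans kN; exact: leq_deg.
Qed.

Lemma boxesD k l N : (k + l)%R \in boxes N -> k \in boxes N /\ l \in boxes N.
Proof.
rewrite !mem_boxes => /forallP kl; split; apply/forallP => i; have := kl i;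
  rewrite ffunE; apply: leq_ltn_trans; [exact: leq_addr|exact: leq_addl].
Qed.

Lemma big_boxes (V : nmodType) (F : idx -> V) N :
  \sum_(k : {ffun 'I_n -> 'I_N}) F (box k) = \sum_(k <- boxes N) F k.
Proof. by rewrite /boxes big_map big_enum; apply: eq_bigl. Qed.

(** The basic computation on convolutions: an indicator of l = k selects one
    term, provided that k is in the box. *)
Lemma big_boxes_delta (V : nmodType) (F : idx -> V) k N :
  \sum_(l <- boxes N) F l *+ (k == l) = F k *+ (k \in boxes N).
Proof.
have [kN|kN] := boolP (k \in boxes N).
  rewrite (bigD1_seq k) ?boxes_uniq //= eqxx big1 ?addr0 // => l lk.
  by rewrite eq_sym (negbTE lk).
by rewrite big_seq big1 // => l lN; case: eqP => // kl; rewrite kl lN in kN.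
Qed.

End MultiIndex.

Section CauchyProduct.
Local Open Scope complex_scope.
Variables (R : realType) (n : nat).
Local Notation idx := (@mindex n).
Local Notation ser := (@Defs.pseries R n).
Implicit Types (f g h : ser) (k l p q : idx) (N : nat).

Definition mono (A : comPzRingType) (y : 'I_n -> A) k : A := \prod_(i < n) y i ^+ k i.

Lemma monoD (A : comPzRingType) (y : 'I_n -> A) k l : mono y (k + l) = mono y k * mono y l.
Proof. by rewrite /mono -big_split /=; apply: eq_bigr => i _; rewrite ffunE exprD. Qed.

Lemma mono0 (A : comPzRingType) (y : 'I_n -> A) : mono y 0 = 1.
Proof. by rewrite /mono big1 // => i _; rewrite ffunE. Qed.

Lemma psumE f y N : psum f y N = \sum_(k <- boxes n N) f k * mono (fun i => y i 0) k.
Proof.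
rewrite -big_boxes; apply: eq_bigr => k _; congr (_ * _).
by apply: eq_bigr => i _; rewrite ffunE.
Qed.

(** The symmetric form of the Cauchy product, from which commutativity,
    associativity and the norm estimate follow by exchanging sums. The box is
    free, so that several coefficients can be written over the same box. *)
Lemma pmulE f g k N : k \in boxes n N ->
  pmul f g k = \sum_(p <- boxes n N) \sum_(q <- boxes n N) (f p * g q) *+ (p + q == k).
Proof.
move=> kN; rewrite /pmul.
pose S := (\sum_(i < n) k i).+1.
set sub : idx -> idx := fun p : idx => [ffun i => (k i - p i)%N].
pose le p := [forall i, (p i <= k i)%N].
have leq_boxes p M : k \in boxes n M -> le p -> p \in boxes n M.
  rewrite !mem_boxes => /forallP kM /forallP pk; apply/forallP => i.
  exact: leq_ltn_trans (pk i) (kM i).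
transitivity (\sum_(p <- boxes n S | le p) f p * g (sub p)).
  rewrite big_map big_enum_cond; apply: eq_big => l; last first.
    by move=> _; congr (_ * g _); apply/ffunP => i; rewrite !ffunE.
  by apply: eq_forallb => i; rewrite ffunE.
transitivity (\sum_(p <- boxes n N | le p) f p * g (sub p)).
  rewrite -big_filter -[RHS]big_filter; apply: perm_big.
  apply: uniq_perm => [||p]; rewrite ?filter_uniq ?boxes_uniq // !mem_filter.
  case lep : (le p) => //=.
  by rewrite (leq_boxes p S) ?(leq_boxes p N) //; apply: boxes_deg; exact: ltnSn.
rewrite big_mkcond; apply: eq_bigr => p _.
case: ifP => [/forallP lep|/negbT lep].
  have e : k = p + sub p by apply/ffunP => i; rewrite !ffunE; exact/esym/subnKC.
  transitivity (\sum_(q <- boxes n N) (f p * g q) *+ (sub p == q)).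
    rewrite big_boxes_delta; case: (boxesD (etrans (congr1 (fun k => k \in boxes n N) (esym e)) kN)).
    by move=> _ ->.
  apply: eq_bigr => q _; congr (_ *+ nat_of_bool _).
  have -> : (p + q == k) = (p + q == p + sub p) by rewrite -e.
  apply/eqP/eqP => [->//|/ffunP h].
  by apply/ffunP => i; apply/esym/(@addnI (p i)); have := h i; rewrite !ffunE.
rewrite big1 // => q _; case: eqP => // e.
by case/negP: lep; apply/forallP => i; rewrite -e ffunE leq_addr.
Qed.

Lemma pmulC f g : pmul f g = pmul g f.
Proof.
apply/funext => k; have kN := boxes_deg (ltnSn (deg k)).
rewrite !(pmulE _ _ kN) exchange_big /=; apply: eq_bigr => p _.
by apply: eq_bigr => q _; rewrite mulrC addrC.
Qed.

Lemma pmul3E f g h k N : k \in boxes n N ->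
  pmul f (pmul g h) k = \sum_(p <- boxes n N) \sum_(q <- boxes n N) \sum_(r <- boxes n N)
     (f p * g q * h r) *+ (p + q + r == k).
Proof.
move=> kN; rewrite (pmulE _ _ kN); apply: eq_bigr => p _.
transitivity (\sum_(s <- boxes n N) \sum_(q <- boxes n N) \sum_(r <- boxes n N)
   ((f p * g q * h r) *+ (p + s == k)) *+ (q + r == s)).
  rewrite [LHS]big_seq [RHS]big_seq; apply: eq_bigr => s sN.
  rewrite (pmulE _ _ sN) mulr_sumr -sumrMnl; apply: eq_bigr => q _.
  rewrite mulr_sumr -sumrMnl; apply: eq_bigr => r _.
  by rewrite mulrnAr mulrA mulrnAC.
rewrite exchange_big; apply: eq_bigr => q _ /=.
rewrite exchange_big; apply: eq_bigr => r _ /=.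
rewrite big_boxes_delta addrA; case: eqP => [e|_]; last by rewrite mul0rn.
have : q + r \in boxes n N.
  by apply: (proj2 (@boxesD n p _ N _)); rewrite addrA e.
by move=> ->.
Qed.

Lemma pmulA f g h : pmul f (pmul g h) = pmul (pmul f g) h.
Proof.
rewrite [RHS]pmulC; apply/funext => k.
have kN := boxes_deg (ltnSn (deg k)).
rewrite !(pmul3E _ _ _ kN); apply/esym.
rewrite exchange_big; apply: eq_bigr => p _ /=.
rewrite exchange_big; apply: eq_bigr => q _ /=.
by apply: eq_bigr => r _; rewrite -mulrA mulrC -addrA addrC.
Qed.

Lemma pmulDl f g h : pmul (fun k => f k + g k) h = (fun k => pmul f h k + pmul g h k).
Proof.
apply/funext => k; have kN := boxes_deg (ltnSn (deg k)).
rewrite !(pmulE _ _ kN) -big_split; apply: eq_bigr => p _ /=.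
by rewrite -big_split; apply: eq_bigr => q _ /=; rewrite mulrDl mulrnDl.
Qed.

Definition pconst (c : R[i]) : ser := fun k => c *+ (k == 0).

Lemma pmul_constl c f k : pmul (pconst c) f k = c * f k.
Proof.
have kN := boxes_deg (ltnSn (deg k)).
rewrite (pmulE _ _ kN).
transitivity (\sum_(p <- boxes n (deg k).+1) (\sum_(q <- boxes n (deg k).+1)
   (c * f q) *+ (k == q)) *+ (0 == p)).
  apply: eq_bigr => p _; rewrite -sumrMnl; apply: eq_bigr => q _.
  rewrite /pconst eq_sym; case: eqP => [<-|_]; last by rewrite mul0r mul0rn.
  by rewrite add0r eq_sym.
by rewrite !big_boxes_delta kN boxes_deg // deg0.
Qed.

Definition abs_sum f (r : R[i]) N := \sum_(k <- boxes n N) `|f k| * r ^+ deg k.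

Lemma psum_abs f (r : R[i]) N :
  psum (fun k => `|f k|) (const_mx r) N = abs_sum f r N.
Proof.
rewrite psumE; apply: eq_bigr => k _; congr (_ * _).
by rewrite /mono /deg -prodrXr; apply: eq_bigr => i _; rewrite mxE.
Qed.

(** Positive elements of R[i] are real, so radii and bounds can be taken in
    R[i]; this avoids all casts in the estimates below. *)
Lemma convergentP f : convergent f <->
  exists r M : R[i], 0 < r /\ forall N, abs_sum f r N <= M.
Proof.
split=> [[r [M [r0 H]]]|[r [M [r0 H]]]].
  by exists r%:C, M%:C; split=> [|N]; rewrite ?ltcR // -psum_abs.
exists (complex.Re r), (complex.Re M).
have rE : (complex.Re r)%:C = r by rewrite RRe_real // gtr0_real.
split=> [|N]; first by rewrite -ltcR rE.
rewrite psum_abs rE RRe_real //.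
have := H 0%N; rewrite /abs_sum.
have : \sum_(k <- boxes n 0) `|f k| * r ^+ deg k \is Num.real.
  by rewrite ger0_real // sumr_ge0 // => k _; rewrite mulr_ge0 // exprn_ge0 // ltW.
by move=> h /ler_real; rewrite h.
Qed.

Lemma abs_sum_ge0 f (r : R[i]) N : 0 <= r -> 0 <= abs_sum f r N.
Proof. by move=> r0; rewrite sumr_ge0 // => k _; rewrite mulr_ge0 // exprn_ge0. Qed.

Lemma abs_sum_le f (r s : R[i]) N : 0 <= r -> r <= s -> abs_sum f r N <= abs_sum f s N.
Proof.
move=> r0 rs; apply: ler_sum => k _; rewrite ler_wpM2l //.
by rewrite lerXn2r // nnegrE // (le_trans r0).
Qed.

Lemma abs_sumD f g (r : R[i]) N : 0 <= r ->
  abs_sum (fun k => f k + g k) r N <= abs_sum f r N + abs_sum g r N.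
Proof.
move=> r0; rewrite -big_split; apply: ler_sum => k _ /=.
by rewrite -mulrDl ler_wpM2r ?exprn_ge0 // ler_normD.
Qed.

Lemma abs_sumM f g (r : R[i]) N : 0 <= r ->
  abs_sum (pmul f g) r N <= abs_sum f r N * abs_sum g r N.
Proof.
move=> r0; rewrite [leRHS]mulr_suml.
apply: le_trans (_ : \sum_(k <- boxes n N) \sum_(p <- boxes n N) \sum_(q <- boxes n N)
   (`|f p| * `|g q| * r ^+ deg k) *+ (p + q == k) <= _).
  rewrite /abs_sum big_seq [leRHS]big_seq; apply: ler_sum => k kN.
  rewrite (pmulE _ _ kN).
  apply: le_trans (ler_wpM2r (exprn_ge0 _ r0) (ler_norm_sum _ _ _)) _.
  rewrite mulr_suml; apply: ler_sum => p _.
  apply: le_trans (ler_wpM2r (exprn_ge0 _ r0) (ler_norm_sum _ _ _)) _.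
  rewrite mulr_suml; apply: ler_sum => q _.
  by rewrite normrMn normrM -mulrnAl.
rewrite exchange_big /=; apply: ler_sum => p _.
rewrite exchange_big /= mulr_sumr; apply: ler_sum => q _.
rewrite big_boxes_delta degD exprD.
have e : `|f p| * `|g q| * (r ^+ deg p * r ^+ deg q) =
  `|f p| * r ^+ deg p * (`|g q| * r ^+ deg q) by ring.
by rewrite -e; case: (_ \in _) => //; rewrite mulr0n !mulr_ge0 // exprn_ge0.
Qed.

(** The radius r s / (r + s) is below both r and s, whatever their order. *)
Lemma common_radius f g : convergent f -> convergent g ->
  exists r M : R[i], [/\ 0 < r, 0 <= M, forall N, abs_sum f r N <= M & forall N, abs_sum g r N <= M].
Proof.
move=> /convergentP[r [M [r0 H]]] /convergentP[s [L [s0 K]]].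
have M0 : 0 <= M := le_trans (abs_sum_ge0 f 0 (ltW r0)) (H 0%N).
have L0 : 0 <= L := le_trans (abs_sum_ge0 g 0 (ltW s0)) (K 0%N).
have rs0 : 0 < r + s by rewrite addr_gt0.
have t0 : 0 < r * s / (r + s) by rewrite divr_gt0 // mulr_gt0.
exists (r * s / (r + s)), (M + L); split=> // [|N|N]; first exact: addr_ge0.
  apply: le_trans (_ : M <= _); last by rewrite lerDl.
  apply: le_trans (H N); apply: abs_sum_le; first exact: ltW.
  by rewrite ler_pdivrMr // ler_pM2l // lerDr ltW.
apply: le_trans (_ : L <= _); last by rewrite lerDr.
apply: le_trans (K N); apply: abs_sum_le; first exact: ltW.
by rewrite ler_pdivrMr // mulrC ler_pM2l // lerDl ltW.
Qed.

Lemma convergentD f g : convergent f -> convergent g -> convergent (fun k => f k + g k).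
Proof.
move=> cf cg; have [r [M [r0 M0 H K]]] := common_radius cf cg.
apply/convergentP; exists r, (M + M); split=> // N.
by apply: le_trans (abs_sumD _ _ _ (ltW r0)) _; rewrite lerD.
Qed.

Lemma convergentM f g : convergent f -> convergent g -> convergent (pmul f g).
Proof.
move=> cf cg; have [r [M [r0 M0 H K]]] := common_radius cf cg.
apply/convergentP; exists r, (M * M); split=> // N.
apply: le_trans (abs_sumM _ _ _ (ltW r0)) _.
by apply: ler_pM => //; apply: abs_sum_ge0; exact: ltW.
Qed.

Lemma convergentN f : convergent f -> convergent (fun k => - f k).
Proof.
move=> /convergentP[r [M [r0 H]]]; apply/convergentP; exists r, M; split=> // N.
rewrite /abs_sum; under eq_bigr do rewrite normrN; exact: H.
Qed.

Lemma convergent_finite f : (exists m, forall k, (m <= deg k)%N -> f k = 0) -> convergent f.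
Proof.
move=> [m H]; apply/convergentP; exists 1, (\sum_(k <- boxes n m) `|f k|); split=> // N.
rewrite /abs_sum; under eq_bigr do rewrite expr1n mulr1.
rewrite (bigID (mem (boxes n m))) /= [X in _ + X]big1 ?addr0; last first.
  move=> k km; rewrite H ?normr0 // leqNgt; apply: contra km; exact: boxes_deg.
rewrite [leRHS](bigID (mem (boxes n N))) /=.
rewrite -[leLHS]big_filter -[X in _ <= X + _]big_filter.
rewrite (perm_big [seq x <- boxes n m | x \in boxes n N]) ?lerDl ?sumr_ge0 //.
apply: uniq_perm => [||k]; rewrite ?filter_uniq ?boxes_uniq // !mem_filter.
exact: andbC.
Qed.

Lemma convergent_const c : convergent (pconst c).
Proof.
apply: convergent_finite; exists 1%N => k k1; rewrite /pconst.
by case: eqP k1 => // ->; rewrite deg0.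
Qed.

End CauchyProduct.

(** * The local ring of convergent power series *)

Section Ring.
Local Open Scope complex_scope.
Variables (R : realType) (n : nat).
Local Notation idx := (@mindex n).
Local Notation K := R[i].

(** Convergence is part of the elements, so that determinants and adjugate
    matrices over this ring are available. *)
Record cps := Cps { cf : @Defs.pseries R n; cfP : convergent cf }.

Lemma cps_eq (f g : cps) : (forall k, cf f k = cf g k) -> f = g.
Proof.
case: f g => [f cf] [g cg] /= /funext e; case: g / e cg => cg.
by rewrite (Prop_irrelevance cf cg).
Qed.

HB.instance Definition _ := gen_eqMixin cps.
HB.instance Definition _ := gen_choiceMixin cps.

Definition cps_const (c : K) := Cps (@convergent_const R n c).
Definition cps_add (f g : cps) := Cps (convergentD (cfP f) (cfP g)).
Definition cps_opp (f : cps) := Cps (convergentN (cfP f)).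
Definition cps_mul (f g : cps) := Cps (convergentM (cfP f) (cfP g)).

Fact cps_addA : associative cps_add.
Proof. by move=> f g h; apply: cps_eq => k /=; rewrite addrA. Qed.
Fact cps_addC : commutative cps_add.
Proof. by move=> f g; apply: cps_eq => k /=; rewrite addrC. Qed.
Fact cps_add0 : left_id (cps_const 0) cps_add.
Proof. by move=> f; apply: cps_eq => k /=; rewrite /pconst mul0rn add0r. Qed.
Fact cps_addN : left_inverse (cps_const 0) cps_opp cps_add.
Proof. by move=> f; apply: cps_eq => k /=; rewrite /pconst mul0rn addNr. Qed.

HB.instance Definition _ := GRing.isZmodule.Build cps cps_addA cps_addC cps_add0 cps_addN.

Fact cps_mulA : associative cps_mul.
Proof. by move=> f g h; apply: cps_eq => k /=; rewrite pmulA. Qed.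
Fact cps_mulC : commutative cps_mul.
Proof. by move=> f g; apply: cps_eq => k /=; rewrite pmulC. Qed.
Fact cps_mul1 : left_id (cps_const 1) cps_mul.
Proof. by move=> f; apply: cps_eq => k /=; rewrite pmul_constl mul1r. Qed.
Fact cps_mulDl : left_distributive cps_mul +%R.
Proof. by move=> f g h; apply: cps_eq => k /=; rewrite pmulDl. Qed.
Fact cps_1neq0 : cps_const 1 != 0.
Proof.
apply/eqP => /(congr1 (fun f => cf f 0)) /=; rewrite /pconst eqxx mulr1n mul0rn.
by move/eqP; rewrite oner_eq0.
Qed.

HB.instance Definition _ := GRing.Zmodule_isComNzRing.Build cps
  cps_mulA cps_mulC cps_mul1 cps_mulDl cps_1neq0.

Lemma cfD f g k : cf (f + g) k = cf f k + cf g k. Proof. by []. Qed.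
Lemma cfN f k : cf (- f) k = - cf f k. Proof. by []. Qed.
Lemma cf0 k : cf 0 k = 0. Proof. exact: mul0rn. Qed.
Lemma cf1 k : cf 1 k = (k == 0)%:R. Proof. by []. Qed.
Lemma cfM f g : cf (f * g) = pmul (cf f) (cf g). Proof. by []. Qed.

Lemma cf_sum (I : Type) (r : seq I) (P : pred I) (F : I -> cps) k :
  cf (\sum_(i <- r | P i) F i) k = \sum_(i <- r | P i) cf (F i) k.
Proof. by apply: (big_morph (fun f => cf f k)) => //; exact: cf0. Qed.

Fact cps_const_additive : zmod_morphism cps_const.
Proof. by move=> c d; apply: cps_eq => k; rewrite /= /pconst mulrnBl. Qed.
Fact cps_const_multiplicative : monoid_morphism cps_const.
Proof. by split=> // c d; apply: cps_eq => k; rewrite /= pmul_constl /pconst mulrnAr. Qed.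
HB.instance Definition _ := GRing.isZmodMorphism.Build K cps cps_const cps_const_additive.
HB.instance Definition _ := GRing.isMonoidMorphism.Build K cps cps_const cps_const_multiplicative.

Lemma cf_constM c f k : cf (cps_const c * f) k = c * cf f k.
Proof. by rewrite /= pmul_constl. Qed.

Definition cst0 (f : cps) : K := cf f 0.
Arguments cst0 : simpl never.

Lemma pmul_eq (f f' g : @Defs.pseries R n) k :
  (forall p : idx, (deg p <= deg k)%N -> f p = f' p) -> pmul f g k = pmul f' g k.
Proof.
move=> H; have kN := boxes_deg (ltnSn (deg k)).
rewrite !(pmulE _ _ kN); apply: eq_bigr => p _; apply: eq_bigr => q _.
by case: eqP => // e; rewrite H // -e degD leq_addr.
Qed.

Lemma cfM_lt (f g : cps) a b : (forall k, (deg k < a)%N -> cf f k = 0) ->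
  (forall k, (deg k < b)%N -> cf g k = 0) ->
  forall k, (deg k < a + b)%N -> cf (f * g) k = 0.
Proof.
move=> fa gb k kab; rewrite cfM (pmulE _ _ (boxes_deg (ltnSn (deg k)))).
rewrite big1 // => p _; rewrite big1 // => q _; case: eqP => // e.
have [pa|pa] := ltnP (deg p) a; first by rewrite fa // mul0r.
rewrite gb ?mulr0 //.
by rewrite -(ltn_add2l (deg p)) -degD e (leq_trans kab) // leq_add2r.
Qed.

Lemma cfX_lt (f : cps) j : cst0 f = 0 -> forall k, (deg k < j)%N -> cf (f ^+ j) k = 0.
Proof.
move=> f0; elim: j => // j IH k kj; rewrite exprS; apply: (cfM_lt (a := 1) _ IH) => // l.
by rewrite ltnS leqn0 deg_eq0 => /eqP->.
Qed.

Lemma cst0M f g : cst0 (f * g) = cst0 f * cst0 g.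
Proof.
rewrite /cst0 cfM.
have -> : pmul (cf f) (cf g) 0 = pmul (pconst (cst0 f)) (cf g) 0.
  apply: pmul_eq => p; rewrite deg0 leqn0 deg_eq0 => /eqP->.
  by rewrite /pconst eqxx.
by rewrite pmul_constl.
Qed.

Fact cst0_additive : zmod_morphism cst0.
Proof. by []. Qed.
Fact cst0_multiplicative : monoid_morphism cst0.
Proof. by split=> [|f g]; [rewrite /cst0 cf1 eqxx|exact: cst0M]. Qed.
HB.instance Definition _ := GRing.isZmodMorphism.Build cps K cst0 cst0_additive.
HB.instance Definition _ := GRing.isMonoidMorphism.Build cps K cst0 cst0_multiplicative.

Lemma cst0D f g : cst0 (f + g) = cst0 f + cst0 g. Proof. by []. Qed.
Lemma cst0B f g : cst0 (f - g) = cst0 f - cst0 g. Proof. by []. Qed.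
Lemma cst0_sum (I : Type) (r : seq I) (P : pred I) (F : I -> cps) :
  cst0 (\sum_(i <- r | P i) F i) = \sum_(i <- r | P i) cst0 (F i).
Proof. exact: cf_sum. Qed.

Lemma cst0_const c : cst0 (cps_const c) = c.
Proof. by rewrite /cst0 /= /pconst eqxx. Qed.

(** Shrinking the radius by s <= 1 multiplies every term of positive degree by
    at most s, and there is no term of degree 0. *)
Lemma small_radius (f : cps) : cst0 f = 0 ->
  exists2 r : K, 0 < r & forall N, abs_sum (cf f) r N <= 2^-1.
Proof.
move=> f0; have /convergentP[r [M [r0 H]]] := cfP f.
have M0 : 0 <= M := le_trans (abs_sum_ge0 _ 0 (ltW r0)) (H 0%N).
have d0 : 0 < 2 * (M + 1) by rewrite mulr_gt0 // ltr_wpDl.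
pose s := (2 * (M + 1))^-1.
have s0 : 0 < s by rewrite invr_gt0.
have s1 : s <= 1.
  by rewrite invf_le1 // mulrDr mulr1 (le_trans (ler1n _ 2)) // lerDr mulr_ge0.
exists (s * r) => [|N]; first exact: mulr_gt0.
apply: le_trans (_ : s * abs_sum (cf f) r N <= _).
  rewrite /abs_sum mulr_sumr; apply: ler_sum => k _.
  have [->|k0] := eqVneq k 0; first by rewrite -/(cst0 f) f0 normr0 !mul0r mulr0.
  rewrite exprMn mulrCA ler_wpM2r //.
    by rewrite mulr_ge0 // exprn_ge0 // ltW.
  move: k0; rewrite -deg_eq0; case: (deg k) => // m _.
  by rewrite exprS ler_piMr ?exprn_ile1 // ltW.
apply: le_trans (ler_wpM2l (ltW s0) (H N)) _.
rewrite /s invfM -mulrA ler_piMr ?invr_ge0 // mulrC ler_pdivrMr ?ltr_wpDl //.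
by rewrite mul1r lerDl.
Qed.

Lemma geo2 J : \sum_(j < J) (2^-1 : K) ^+ j <= 2.
Proof.
have -> : \sum_(j < J) (2^-1 : K) ^+ j = 2 - 2 * 2^-1 ^+ J.
  elim: J => [|J IH]; first by rewrite big_ord0 expr0; ring.
  by rewrite big_ord_recr /= IH exprS; field.
by rewrite gerBl mulr_ge0 // exprn_ge0 // invr_ge0.
Qed.

(** The inverse is the geometric series sum_j g^j. Its coefficients are finite
    sums, because g^j starts in degree j, and at a radius where g has norm at
    most 1/2 the series has norm at most 2. *)
Lemma cps_unit_sub1 (g : cps) : cst0 g = 0 -> exists h, (1 - g) * h = 1.
Proof.
move=> g0; have [r r0 H] := small_radius g0.
pose c k := \sum_(j < (deg k).+1) cf (g ^+ j) k.
have cE k J : (deg k < J)%N -> c k = \sum_(j < J) cf (g ^+ j) k.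
  move=> kJ; rewrite /c (big_ord_widen J (fun j => cf (g ^+ j) k)) //.
  rewrite big_mkcond; apply: eq_bigr => j _; case: ifP => // /negbT.
  by rewrite -leqNgt => jk; rewrite cfX_lt.
have gj j N : abs_sum (cf (g ^+ j)) r N <= 2^-1 ^+ j.
  elim: j => [|j IH].
    rewrite expr0 /abs_sum big_seq.
    apply: le_trans (_ : \sum_(k <- boxes n N) 1 *+ (0 == k) <= _).
      rewrite -big_seq; apply: ler_sum => k _; rewrite cf1 eq_sym.
      by case: eqP => [<-|_]; rewrite ?normr0 ?mul0r // normr1 deg0 expr0 mulr1.
    by rewrite big_boxes_delta; case: (_ \in _) => //; exact: ler01.
  rewrite exprS cfM; apply: le_trans (abs_sumM _ _ _ (ltW r0)) _.
  by rewrite exprS ler_pM // abs_sum_ge0 // ltW.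
have cc : convergent c.
  apply/convergentP; exists r, 2; split=> // N.
  apply: le_trans (geo2 (n * N).+1).
  apply: le_trans (_ : \sum_(j < (n * N).+1) abs_sum (cf (g ^+ j)) r N <= _); last first.
    by apply: ler_sum => j _; exact: gj.
  rewrite /abs_sum exchange_big /= big_seq [leRHS]big_seq; apply: ler_sum => k kN.
  rewrite (cE k (n * N).+1); last first.
    rewrite ltnS /deg -[n in (n * _)%N]card_ord -sum_nat_const; apply: leq_sum => i _.
    by move: kN; rewrite mem_boxes => /forallP/(_ i)/ltnW.
  by rewrite -mulr_suml ler_wpM2r ?ler_norm_sum // exprn_ge0 // ltW.
exists (Cps cc); apply: cps_eq => k.
set J := (deg k).+1.
have -> : cf ((1 - g) * Cps cc) k = cf ((1 - g) * \sum_(j < J) g ^+ j) k.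
  rewrite mulrC [in RHS]mulrC !cfM; apply: pmul_eq => p pk /=.
  by rewrite (cE p J) // cf_sum.
have -> : (1 - g) * \sum_(j < J) g ^+ j = 1 - g ^+ J.
  by rewrite -opprB mulNr -subrX1 opprB.
by rewrite cfD cfN cfX_lt // subr0.
Qed.

Lemma cps_unit (f : cps) : cst0 f != 0 -> exists h, f * h = 1.
Proof.
move=> f0; pose a := cst0 f.
have [|h Hh] := @cps_unit_sub1 (1 - cps_const a^-1 * f).
  by rewrite rmorphB rmorph1 /= cst0M cst0_const mulVf // subrr.
exists (cps_const a^-1 * h); rewrite mulrCA mulrA -Hh; congr (_ * _).
by rewrite opprB addrCA subrr addr0.
Qed.

Definition unit_idx (i : 'I_n) : idx := [ffun j => (j == i) : nat].

Lemma deg_unit i : deg (unit_idx i) = 1%N.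
Proof.
rewrite /deg (bigD1 i) //= ffunE eqxx big1 // => j /negbTE ji.
by rewrite ffunE ji.
Qed.

Lemma convergent_var i : convergent (fun k : idx => (k == unit_idx i)%:R : K).
Proof.
apply: convergent_finite; exists 2%N => k k2; case: eqP => // e.
by rewrite e deg_unit in k2.
Qed.

Definition var i : cps := Cps (convergent_var i).

Lemma cst0_var i : cst0 (var i) = 0.
Proof.
rewrite /cst0 /=; case: eqP => // e; have := deg_unit i.
by rewrite -e deg0.
Qed.

Lemma cfM_var (f : cps) i k :
  cf (f * var i) k = \sum_(p <- boxes n (deg k).+1) cf f p *+ (p + unit_idx i == k).
Proof.
rewrite cfM (pmulE _ _ (boxes_deg (ltnSn (deg k)))) /=; apply: eq_bigr => p _.
transitivity (\sum_(q <- boxes n (deg k).+1) (cf f p *+ (p + q == k)) *+ (unit_idx i == q)).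
  by apply: eq_bigr => q _; rewrite eq_sym mulr_natr mulrnAC.
rewrite big_boxes_delta; case: eqP => [e|_]; last by rewrite mul0rn.
have /boxesD[_ ->//] : p + unit_idx i \in boxes n (deg k).+1 by rewrite e boxes_deg.
Qed.

Lemma addk_inj (u : idx) : injective (fun p : idx => p + u).
Proof.
move=> p q /ffunP h; apply/ffunP => i; apply/(@addIn (u i)).
by have := h i; rewrite !ffunE.
Qed.

Lemma cfM_varD (f : cps) i p : cf (f * var i) (p + unit_idx i) = cf f p.
Proof.
rewrite cfM_var.
under eq_bigr => q _ do rewrite (inj_eq (@addk_inj (unit_idx i))) eq_sym.
by rewrite big_boxes_delta boxes_deg // degD ltnS leq_addr.
Qed.

Lemma cfM_var0 (f : cps) i (k : idx) : k i = 0%N -> cf (f * var i) k = 0.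
Proof.
move=> ki; rewrite cfM_var big1 // => p _; case: eqP => // e.
by move: ki; rewrite -e idxDE ffunE eqxx addn1.
Qed.

Lemma cf_cst0M_var (f : cps) i j : cf (f * var i) (unit_idx j) = cst0 f * (i == j)%:R.
Proof.
have [->|ij] := eqVneq i j.
  by rewrite -[unit_idx j]add0r cfM_varD mulr1.
by rewrite cfM_var0 ?mulr0 // ffunE (negbTE ij).
Qed.

Lemma ler_sum_uniq (T : eqType) (s t : seq T) (F : T -> K) : uniq s -> uniq t ->
  {subset s <= t} -> (forall x, 0 <= F x) -> \sum_(x <- s) F x <= \sum_(x <- t) F x.
Proof.
move=> us ut st F0; rewrite [leRHS](bigID (mem s)) /= -[X in _ <= X + _]big_filter.
have -> : \sum_(i <- [seq i <- t | i \in s]) F i = \sum_(i <- s) F i.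
  apply: perm_big; apply: uniq_perm => [||x]; rewrite ?filter_uniq // mem_filter /=.
  by case xs : (x \in s) => //=; apply: st.
by rewrite lerDl sumr_ge0.
Qed.

(** The factor (p_i + 1) / (deg p + 1), which is at most 1, is the share of
    the variable of index i in the decomposition of [hadamard]. *)
Lemma convergent_shift (f : cps) i :
  convergent (fun p => cf f (p + unit_idx i) * ((p i).+1%:R / (deg p).+1%:R)).
Proof.
have /convergentP[r [M [r0 H]]] := cfP f.
apply/convergentP; exists r, (r^-1 * M); split=> // N.
apply: le_trans (ler_wpM2l (ltW _) (H N.+1)); last by rewrite invr_gt0.
apply: le_trans (_ : r^-1 * \sum_(k <- [seq p + unit_idx i | p <- boxes n N]) `|cf f k| * r ^+ deg k <= _).
  rewrite big_map mulr_sumr; apply: ler_sum => p _.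
  rewrite degD deg_unit addn1 exprS [leRHS]mulrCA mulKf ?lt0r_neq0 //.
  rewrite ler_wpM2r ?exprn_ge0 // ?(ltW r0) // normrM ler_piMr //.
  by rewrite normrM normfV !normr_nat ler_pdivrMr ?ltr0n // mul1r ler_nat ltnS leq_deg.
rewrite ler_wpM2l ?invr_ge0 ?(ltW r0) //; apply: ler_sum_uniq.
- by rewrite map_inj_uniq ?boxes_uniq //; exact: addk_inj.
- exact: boxes_uniq.
- move=> k /mapP[p pN ->]; move: pN; rewrite !mem_boxes => /forallP pN.
  apply/forallP => j; rewrite idxDE ffunE; have := pN j.
  by case: (j == i) => /=; rewrite ?addn1 ?addn0 // => /leqW.
- by move=> k; rewrite mulr_ge0 // exprn_ge0 // ltW.
Qed.

(** By Euler's identity sum_i k_i = deg k, the monomial of index k can be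
    shared among the variables in proportion k_i / deg k. *)
Lemma hadamard (f : cps) : cst0 f = 0 ->
  exists h : 'I_n -> cps, f = \sum_i h i * var i.
Proof.
move=> f0; exists (fun i => Cps (convergent_shift f i)); apply: cps_eq => k.
rewrite cf_sum.
have [->|k0] := eqVneq k 0.
  rewrite -/(cst0 f) f0 big1 // => i _; apply: cfM_var0; exact: ffunE.
transitivity (\sum_(i < n) cf f k * ((k i)%:R / (deg k)%:R)).
  rewrite -mulr_sumr -mulr_suml -natr_sum -/(deg k) divff ?mulr1 //.
  by rewrite pnatr_eq0 deg_eq0.
apply: eq_bigr => i _.
have [ki|ki] := posnP (k i); first by rewrite cfM_var0 // ki mul0r mulr0.
pose p : idx := [ffun j => (k j - unit_idx i j)%N].
have e : k = p + unit_idx i.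
  apply/ffunP => j; rewrite idxDE !ffunE; apply/esym/subnK.
  by case: eqP => // ->.
rewrite e cfM_varD /= degD deg_unit addn1; congr (_ * (_%:R / _)).
by rewrite idxDE !ffunE eqxx addn1.
Qed.

End Ring.

(** * Ideals, dimension of the quotient, and Nakayama's lemma *)

Section Ideals.
Local Open Scope complex_scope.
Variables (R : realType) (n : nat).
Local Notation K := R[i].
Local Notation O := (@cps R n).
Local Notation C_ := (@cps_const R n).

Definition inI s (F : 'I_s -> O) (h : O) := exists g : 'I_s -> O, h = \sum_i g i * F i.

Section Closure.
Variables (s : nat) (F : 'I_s -> O).

Lemma inI0 : inI F 0.
Proof. by exists (fun=> 0); rewrite big1 // => i _; rewrite mul0r. Qed.

Lemma inID f g : inI F f -> inI F g -> inI F (f + g).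
Proof.
move=> [a ->] [b ->]; exists (fun i => a i + b i).
by rewrite -big_split; apply: eq_bigr => i _; rewrite mulrDl.
Qed.

Lemma inIM f g : inI F g -> inI F (f * g).
Proof.
move=> [a ->]; exists (fun i => f * a i).
by rewrite mulr_sumr; apply: eq_bigr => i _; rewrite mulrA.
Qed.

Lemma inIN f : inI F f -> inI F (- f).
Proof. by move=> h; rewrite -mulN1r; exact: inIM. Qed.

Lemma inIB f g : inI F f -> inI F g -> inI F (f - g).
Proof. by move=> hf hg; apply: inID => //; exact: inIN. Qed.

Lemma inI_sum (I : Type) (r : seq I) (P : pred I) (f : I -> O) :
  (forall i, P i -> inI F (f i)) -> inI F (\sum_(i <- r | P i) f i).
Proof. by move=> H; elim/big_ind: _ => //; [exact: inI0|exact: inID]. Qed.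

Definition lin m (t : 'I_m -> O) (u : 'rV[K]_m) : O := \sum_j C_ (u 0 j) * t j.

Definition spans m (t : 'I_m -> O) := forall h, exists u, inI F (h - lin t u).
Definition indep m (t : 'I_m -> O) := forall u, inI F (lin t u) -> u = 0.

Lemma linB m (t : 'I_m -> O) u v : lin t (u - v) = lin t u - lin t v.
Proof.
by rewrite -sumrB; apply: eq_bigr => j _; rewrite !mxE rmorphB mulrBl.
Qed.

Lemma cf_lin m (t : 'I_m -> O) u k :
  cf (lin t u) k = \sum_j u 0 j * cf (t j) k.
Proof. by rewrite cf_sum; apply: eq_bigr => j _; rewrite cf_constM. Qed.

(** Independence and generation modulo the ideal are not stated as properties
    of a quotient space; this is the comparison of cardinalities that linear
    algebra gives in that space. *)
Lemma indep_le_spans p m (t : 'I_p -> O) (e : 'I_m -> O) :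
  indep t -> spans e -> (p <= m)%N.
Proof.
move=> ti es; rewrite leqNgt; apply/negP => mp.
have [T HT] := fin_all_exists (fun j => es (t j)).
pose M : 'M[K]_(p, m) := \matrix_j T j.
have : kermx M != 0.
  rewrite -mxrank_eq0 mxrank_ker subn_eq0 -ltnNge.
  exact: leq_ltn_trans (rank_leq_col M) mp.
case/rowV0Pn => u /sub_kermxP uM /negP[]; apply/eqP; apply: ti.
have -> : lin t u = \sum_j C_ (u 0 j) * (t j - lin e (T j)).
  under [RHS]eq_bigr do rewrite mulrBr.
  rewrite sumrB -[LHS]subr0; congr (_ - _); apply/esym.
  under eq_bigr do rewrite mulr_sumr.
  rewrite exchange_big big1 // => k _.
  under eq_bigr do rewrite mulrA -rmorphM.
  rewrite -mulr_suml -rmorph_sum.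
  have := congr1 (fun A : 'rV_m => A 0 k) uM; rewrite !mxE.
  under eq_bigr do rewrite mxE.
  by move=> ->; rewrite rmorph0 mul0r.
by apply: inI_sum => j _; exact: inIM.
Qed.

Lemma in_idealE (f : O) : in_ideal (fun i => cf (F i)) (cf f) <-> inI F f.
Proof.
split=> [[g [gc H]]|[g ->]].
  exists (fun i => Cps (gc i)); apply: cps_eq => k; rewrite H cf_sum.
  by apply: eq_bigr.
exists (fun i => cf (g i)); split=> [i|k]; first exact: cfP.
by rewrite cf_sum; apply: eq_bigr.
Qed.

Lemma quotient_dimE m : quotient_dim (fun i => cf (F i)) m <->
  exists t : 'I_m -> O, spans t /\ indep t.
Proof.
have sub (h : O) (t : 'I_m -> O) (u : 'rV[K]_m) :
    (fun k => cf h k - \sum_(j < m) u 0 j * cf (t j) k) = cf (h - lin t u).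
  by apply/funext => k; rewrite cfD cfN cf_lin.
split=> [[e [ec H]]|[t [ts ti]]].
  pose t j := Cps (ec j); exists t; split=> [h|u hu].
    have [u [hu _]] := H _ (cfP h); exists u; apply/in_idealE.
    by rewrite -sub.
  have lin0 : lin t 0 = 0 by rewrite -(subrr 0) linB subrr.
  have [v [_ vu]] := H _ (cfP 0).
  rewrite -(vu 0); last first.
    by rewrite (sub 0 t 0) in_idealE lin0 subr0; exact: inI0.
  by apply/esym/vu; rewrite (sub 0 t u) in_idealE sub0r; exact: inIN.
exists (fun j => cf (t j)); split=> [j|h hc]; first exact: cfP.
have [u hu] := ts (Cps hc); exists u; split=> [|v].
  by rewrite (sub (Cps hc) t u) in_idealE.
rewrite (sub (Cps hc) t v) in_idealE => hv; apply/eqP; rewrite -subr_eq0; apply/eqP.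
apply: ti; rewrite linB.
have -> : lin t u - lin t v = (Cps hc - lin t v) - (Cps hc - lin t u) by ring.
exact: inIB.
Qed.
End Closure.

Definition jac s (F : 'I_s -> O) : 'M[K]_(s, n) := \matrix_(i, l) cf (F i) (unit_idx l).

(** Write G = H Y with Y the column of the variables and H a matrix over the
    local ring. The constant term of det H is the determinant of the Jacobian
    matrix, so det H is a unit and the adjugate matrix of H expresses Y
    through G. *)
Lemma nakayama (G : 'I_n -> O) : (forall i, cst0 (G i) = 0) -> jac G \in unitmx ->
  forall l, inI G (@var R n l).
Proof.
move=> G0 GJ l.
have [H HE] := fin_all_exists (fun i => hadamard (G0 i)).
pose M : 'M[O]_n := \matrix_(i, j) H i j.
have MJ : map_mx (@cst0 R n) M = jac G.
  apply/matrixP => i j; rewrite !mxE HE cf_sum.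
  under eq_bigr do rewrite cf_cst0M_var.
  by rewrite (bigD1 j) //= eqxx mulr1 big1 ?addr0 // => k /negbTE->; rewrite mulr0.
have [v Hv] : exists v, \det M * v = 1.
  by apply: cps_unit; rewrite -det_map_mx MJ -unitfE -unitmxE.
exists (fun i => v * \adj M l i).
transitivity (v * (\sum_i \adj M l i * G i)); last first.
  by rewrite mulr_sumr; apply: eq_bigr => i _; rewrite mulrA.
have -> : \sum_i \adj M l i * G i = \sum_j (\adj M *m M) l j * @var R n j.
  under [RHS]eq_bigr do rewrite mxE mulr_suml.
  rewrite exchange_big; apply: eq_bigr => i _ /=.
  by rewrite HE mulr_sumr; apply: eq_bigr => j _; rewrite [M i j]mxE mulrA.
rewrite mul_adj_mx (bigD1 l) //= big1 => [|j]; last first.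
  by rewrite mxE eq_sym => /negbTE->; rewrite mul0r.
by rewrite mxE eqxx mulr1n addr0 mulrA [v * _]mulrC Hv mul1r.
Qed.

Lemma inI_max s (F : 'I_s -> O) : (forall l, inI F (@var R n l)) ->
  forall h, inI F (h - C_ (cst0 h)).
Proof.
move=> Fl h; have [|g ->] := @hadamard _ _ (h - C_ (cst0 h)).
  by apply/eqP; rewrite rmorphB subr_eq0; apply/eqP; exact/esym/cst0_const.
by apply: inI_sum => i _; exact: inIM.
Qed.

Section Powers.
Variables (s : nat) (F : 'I_s -> O) (w : O).
Hypothesis maxE : forall h, exists g, inI F (h - C_ (cst0 h) - g * w).

Definition pow m (k : 'I_m) : O := w ^+ k.

(** If the maximal ideal is generated by w modulo the ideal, each series has a
    Taylor expansion in w with a remainder. *)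
Lemma pow_expansion m h : exists u g, inI F (h - lin (@pow m) u - g * w ^+ m).
Proof.
elim: m => [|m [u [g H]]].
  exists 0, h; rewrite /lin big_ord0 subr0 expr0 mulr1 subrr; exact: inI0.
have [g' H'] := maxE g.
exists (\row_(j < m.+1) if unlift ord_max j is Some i then u 0 i else cst0 g), g'.
rewrite /lin big_ord_recr /= mxE unlift_none.
have -> : \sum_(i < m) C_ ((\row_(j < m.+1) (if unlift ord_max j is Some i then u 0 i else cst0 g)) 0
   (widen_ord (leqnSn m) i)) * @pow m.+1 (widen_ord (leqnSn m) i) = lin (@pow m) u.
  apply: eq_bigr => i _; rewrite mxE /pow /=.
  have -> : widen_ord (leqnSn m) i = lift ord_max i by apply: val_inj; rewrite /= /bump leqNgt ltn_ord.
  by rewrite liftK.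
rewrite /pow /= exprS.
have -> : h - (lin (@pow m) u + C_ (cst0 g) * w ^+ m) - g' * (w * w ^+ m) =
   (h - lin (@pow m) u - g * w ^+ m) + w ^+ m * (g - C_ (cst0 g) - g' * w) by ring.
by apply: inID => //; exact: inIM.
Qed.

Lemma spans_pow m : inI F (w ^+ m) -> spans F (@pow m).
Proof.
move=> wm h; have [u [g H]] := pow_expansion m h; exists u.
have -> : h - lin (@pow m) u = (h - lin (@pow m) u - g * w ^+ m) + g * w ^+ m by ring.
by apply: inID => //; exact: inIM.
Qed.

End Powers.

End Ideals.

(** * Polynomials modulo a power of the variable, and binomial powers *)

Definition gbinom (K : fieldType) (al : K) k : K :=
  \prod_(i < k) ((al - i%:R) / i.+1%:R).

Lemma gbinomS (K : numFieldType) (al : K) k :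
  k.+1%:R * gbinom al k.+1 = (al - k%:R) * gbinom al k.
Proof.
by rewrite /gbinom big_ord_recr /= mulrCA [_ / _]mulrC mulVKf ?pnatr_eq0 // mulrC.
Qed.

Lemma gbinom_bound (K : numFieldType) (al : K) k :
  `|gbinom al k| <= (`|al| + 1) ^+ k.
Proof.
rewrite normr_prod -[k in _ ^+ k]card_ord -prodr_const.
apply: ler_prod => i _; rewrite normr_ge0 /= normrM normfV normr_nat.
rewrite ler_pdivrMr ?ltr0n //; apply: le_trans (ler_normB _ _) _.
rewrite normr_nat mulrDl mul1r lerD //.
  by rewrite ler_peMr // ler1n.
by rewrite ler_nat.
Qed.

Section EqX.
Variable K : numFieldType.
Implicit Types (p q r s f g : {poly K}) (M m : nat).

Definition eqX M p q := forall i, (i < M)%N -> p`_i = q`_i.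

Lemma eqX_refl M p : eqX M p p. Proof. by []. Qed.
Lemma eqX_sym M p q : eqX M p q -> eqX M q p.
Proof. by move=> h i iM; rewrite h. Qed.
Lemma eqX_trans M p q r : eqX M p q -> eqX M q r -> eqX M p r.
Proof. by move=> h h' i iM; rewrite h ?h'. Qed.
Lemma eqXW M m p q : (m <= M)%N -> eqX M p q -> eqX m p q.
Proof. by move=> mM h i im; apply: h; exact: leq_trans mM. Qed.
Lemma eqXD M p q r s : eqX M p q -> eqX M r s -> eqX M (p + r) (q + s).
Proof. by move=> h h' i iM; rewrite !coefD h ?h'. Qed.
Lemma eqXN M p q : eqX M p q -> eqX M (- p) (- q).
Proof. by move=> h i iM; rewrite !coefN h. Qed.
Lemma eqXM M p q r s : eqX M p q -> eqX M r s -> eqX M (p * r) (q * s).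
Proof.
move=> h h' i iM; rewrite !coefM; apply: eq_bigr => j _.
by rewrite h ?h' // (leq_ltn_trans _ iM) // ?leq_subr // -ltnS.
Qed.
Lemma eqXZ M c p q : eqX M p q -> eqX M (c *: p) (c *: q).
Proof. by move=> h i iM; rewrite !coefZ h. Qed.
Lemma eqX_sum (I : Type) (t : seq I) (P : pred I) M (F G : I -> {poly K}) :
  (forall i, P i -> eqX M (F i) (G i)) -> eqX M (\sum_(i <- t | P i) F i) (\sum_(i <- t | P i) G i).
Proof. by move=> H; elim/big_ind2: _ => // p q r s; exact: eqXD. Qed.
Lemma eqX_mulXn M p : eqX M ('X^M * p) 0.
Proof. by move=> i iM; rewrite coefXnM iM coef0. Qed.
Lemma eqX0P M p : eqX M p 0 -> exists q, p = 'X^M * q.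
Proof.
move=> h; exists (drop_poly M p); rewrite -[LHS](poly_take_drop M) mulrC.
suff -> : take_poly M p = 0 by rewrite add0r.
by apply/polyP => i; rewrite coef_take_poly coef0; case: ifP => // /h; rewrite coef0.
Qed.

Lemma coefX_low p k i : p`_0 = 0 -> (i < k)%N -> (p ^+ k)`_i = 0.
Proof.
move=> p0 ik; have [|q ->] := @eqX0P 1 p; first by case=> // _; rewrite p0 coef0.
by rewrite expr1 exprMn coefXnM ik.
Qed.

Lemma coefX_diag p k : p`_0 = 0 -> (p ^+ k)`_k = p`_1 ^+ k.
Proof.
move=> p0; have [|q ->] := @eqX0P 1 p; first by case=> // _; rewrite p0 coef0.
rewrite expr1 exprMn coefXnM ltnn subnn coefXM /=.
by rewrite -!horner_coef0 horner_exp.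
Qed.

(** The powers of a polynomial p that vanishes at order exactly 1 form a
    triangular system: p^i starts in degree i with coefficient p_1^i. *)
Lemma coef_triangular m (a : 'I_m -> K) p (k : 'I_m) : p`_0 = 0 ->
  (forall i : 'I_m, (i < k)%N -> a i = 0) ->
  (\sum_(i < m) a i *: p ^+ i)`_k = a k * p`_1 ^+ k.
Proof.
move=> p0 H; rewrite coef_sum (bigD1 k) //= coefZ coefX_diag // big1 ?addr0 // => i ik.
rewrite coefZ; have [lik|lki|/val_inj e] := ltngtP i k; first by rewrite H // mul0r.
  by rewrite coefX_low // mulr0.
by rewrite e eqxx in ik.
Qed.

Lemma triangular_vanish m (a : 'I_m -> K) p j : p`_0 = 0 -> p`_1 != 0 ->
  eqX j (\sum_(i < m) a i *: p ^+ i) 0 -> forall k : 'I_m, (k < j)%N -> a k = 0.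
Proof.
move=> p0 p1 H [k km]; elim/ltn_ind: k km => k IH km kj.
have := H k kj; rewrite (@coef_triangular _ _ _ (Ordinal km)) // => [|i ik]; last first.
  by case: i ik => i im /= ik; apply: IH => //; exact: ltn_trans kj.
by rewrite coef0 => /eqP; rewrite mulf_eq0 expf_eq0 (negbTE p1) andbF orbF => /eqP.
Qed.

(** The coefficient of degree i of f^`() is (i + 1) f_(i+1), so a linear
    differential equation determines the coefficients one after the other. *)
Lemma ode_unique m f g p : f`_0 = g`_0 -> eqX m f^`() (f * p) -> eqX m g^`() (g * p) ->
  eqX m.+1 f g.
Proof.
move=> fg0 Hf Hg; elim/ltn_ind => [[|i]] IH im //.
have := Hf i im; have := Hg i im; rewrite !coef_deriv => eg ef.
have : f`_i.+1 *+ i.+1 = g`_i.+1 *+ i.+1.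
  rewrite ef eg !coefM; apply: eq_bigr => j _; rewrite IH //.
  exact: leq_trans (ltn_ord j) (ltnW im).
by move=> /eqP; rewrite eqrMn2r => /eqP.
Qed.

(** The exponential of the primitive of p, truncated; each order adds one
    monomial whose coefficient kills the next term of the error. *)
Lemma exp_exists m p : exists2 f : {poly K}, f`_0 = 1 & eqX m f^`() (f * p).
Proof.
elim: m => [|m [f f0 H]]; first by exists 1; rewrite ?coefC.
have [|r Hr] := @eqX0P m (f^`() - f * p).
  by move=> i im; rewrite coefB H // subrr coef0.
exists (f - (r`_0 / m.+1%:R) *: 'X^(m.+1)).
  by rewrite coefB coefZ coefXn mulr0 subr0.
have fE : f^`() = f * p + 'X^m * r by rewrite -Hr addrC subrK.
rewrite derivB derivZ derivXn fE => i; rewrite ltnS => im.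
rewrite mulrBl !coefB coefD coefXnM -scalerAl !coefZ coefXnM ltnS im mulr0 subr0.
rewrite coefMn coefXn; move: im; rewrite leq_eqVlt => /orP[/eqP->|im].
  rewrite ltnn subnn eqxx -mulr_natl mulr1 divfK ?pnatr_eq0 //; ring.
by rewrite im (ltn_eqF im) mul0rn mulr0; ring.
Qed.

Lemma ode_mul m f1 p1 f2 p2 : eqX m f1^`() (f1 * p1) -> eqX m f2^`() (f2 * p2) ->
  eqX m (f1 * f2)^`() (f1 * f2 * (p1 + p2)).
Proof.
move=> H1 H2; rewrite derivM.
have -> : f1 * f2 * (p1 + p2) = f1 * p1 * f2 + f1 * (f2 * p2) by ring.
by apply: eqXD; apply: eqXM => //; exact: eqX_refl.
Qed.

Lemma ode_prod (I : finType) m (f p : I -> {poly K}) :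
  (forall l, eqX m (f l)^`() (f l * p l)) ->
  eqX m (\prod_l f l)^`() ((\prod_l f l) * \sum_l p l).
Proof.
move=> H; elim/big_ind2: _ => [|f1 p1 f2 p2 H1 H2|l _]; last exact: H.
  by rewrite mulr0 derivC.
exact: ode_mul.
Qed.

(** A polynomial with non-zero constant term is invertible modulo every power
    of the variable. *)
Lemma eqX_cancel m f p q : f`_0 != 0 -> eqX m (f * p) (f * q) -> eqX m p q.
Proof.
move=> f0 H; elim/ltn_ind => i IH im.
have := H i im; rewrite !coefM !big_ord_recl /= !subn0.
have -> : \sum_(j < i) f`_(bump 0 j) * p`_(i - bump 0 j) =
          \sum_(j < i) f`_(bump 0 j) * q`_(i - bump 0 j).
  apply: eq_bigr => j _; congr (_ * _); apply: IH.
    by rewrite /bump /= add1n subnSK ?leq_subr // ltn_ord.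
  by rewrite (leq_ltn_trans _ im) // leq_subr.
by move=> /addIr/(mulfI f0).
Qed.

Definition binom_trunc (al : K) M (y : {poly K}) := \sum_(k < M) gbinom al k *: y ^+ k.

(** The binomial series b satisfies (1 + y) b' = al y' b, because of the
    recurrence [gbinomS]; truncation only changes terms that are multiples of
    y^m. So if 1 + y is the exponential of a primitive of p, then b is the
    exponential of a primitive of al p. *)
Lemma binom_trunc_ode (al : K) m (y p : {poly K}) : y`_0 = 0 -> eqX m y^`() ((1 + y) * p) ->
  eqX m (binom_trunc al m.+1 y)^`() (binom_trunc al m.+1 y * (al *: p)).
Proof.
move=> y0 Hy; apply: (@eqX_cancel _ (1 + y)); first by rewrite coefD y0 addr0 coefC oner_eq0.
set b := binom_trunc al m.+1 y.
have yk k : eqX m (y ^+ m * k) 0.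
  move=> i im; have [|q ->] := @eqX0P 1 y; first by case=> // _; rewrite y0 coef0.
  by rewrite expr1 exprMn -mulrA eqX_mulXn.
have e : (1 + y) * b^`() = al *: b * y^`() - y ^+ m * ((al - m%:R) * gbinom al m *: y^`()).
  have -> : b^`() = (\sum_(k < m) ((al - k%:R) * gbinom al k) *: y ^+ k) * y^`().
    rewrite /b /binom_trunc raddf_sum big_ord_recl /= derivZ expr0 derivC scaler0 add0r.
    rewrite mulr_suml; apply: eq_bigr => k _.
    rewrite derivZ deriv_exp /= -gbinomS /bump /= add1n.
    by rewrite -scaler_nat scalerA [_ * _%:R]mulrC [y^`() * _]mulrC scalerAl.
  have -> : (1 + y) * ((\sum_(k < m) ((al - k%:R) * gbinom al k) *: y ^+ k) * y^`())
    = ((\sum_(k < m) ((al - k%:R) * gbinom al k) *: y ^+ k) +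
       \sum_(k < m) (k.+1%:R * gbinom al k.+1) *: y ^+ k.+1) * y^`().
    rewrite mulrA; congr (_ * _); rewrite mulrDl mul1r; congr (_ + _).
    rewrite mulr_sumr; apply: eq_bigr => k _.
    by rewrite gbinomS -scalerAr -exprS.
  have -> : \sum_(k < m) (k.+1%:R * gbinom al k.+1) *: y ^+ k.+1 =
     \sum_(k < m.+1) (k%:R * gbinom al k) *: y ^+ k.
    by rewrite [RHS]big_ord_recl mul0r scale0r add0r.
  have -> : \sum_(k < m) ((al - k%:R) * gbinom al k) *: y ^+ k =
     \sum_(k < m.+1) ((al - k%:R) * gbinom al k) *: y ^+ k - ((al - m%:R) * gbinom al m) *: y ^+ m.
    by rewrite big_ord_recr /= addrK.
  rewrite addrAC -big_split /= mulrBl -scalerAl -scalerAr -scalerAl; congr (_ - _); rewrite scalerAl; congr (_ * _).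
  rewrite /b /binom_trunc scaler_sumr; apply: eq_bigr => k _.
  by rewrite -scalerDl scalerA -mulrDl subrK.
rewrite e; apply: eqX_trans (_ : eqX m (al *: b * y^`()) _).
  rewrite -[X in eqX _ _ X]subr0; apply: eqXD => //; apply: eqXN; exact: yk.
apply: eqX_trans (eqXM (@eqX_refl _ _) Hy) _.
have -> : al *: b * ((1 + y) * p) = (1 + y) * (b * (al *: p)) by rewrite -!scalerAl -!scalerAr; congr (_ *: _); ring.
exact: eqX_refl.
Qed.

End EqX.

(** * The curve of approximate solutions *)

Section Curve.
Variables (K : numFieldType) (n : nat).
Implicit Types (m : nat).

(** The coordinates 1 + y_l of the curve have the logarithmic derivatives q_l
    = sum_k (-1)^k z_(k+1,l) t^k, and that of u is - p0 with p0 = sum_k (-1)^k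
    c_(k+1) t^k. The hypothesis gives sum_l al_jl q_l = D_j - p0, where D_j
    agrees up to degree m - 2 with the derivative d_j / (1 + d_j t) of log (1
    + d_j t). Both sides of the conclusion solve the same differential
    equation modulo t^m; the last term accounts for the first discrepancy, d_j
    - (1 + d_j t) D_j = (-1)^(m-1) d_j^m t^(m-1). *)
Lemma curve_exists (J : finType) m (al : J -> 'I_n -> K) (d : J -> K)
    (z : nat -> 'I_n -> K) (c : nat -> K) : (1 < m)%N ->
  (forall k j, (0 < k < m)%N -> d j ^+ k = \sum_l al j l * z k l + c k) ->
  exists (y : 'I_n -> {poly K}) (u : {poly K}),
  [/\ forall l, (y l)`_0 = 0, forall l, (y l)`_1 = z 1%N l, u`_0 = 1 &
   forall j, eqX m.+1 (\prod_l binom_trunc (al j l) m.+1 (y l))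
     (u * (1 + d j *: 'X) + ((-1) ^+ m / m%:R * d j ^+ m) *: 'X^m)].
Proof.
case: m => [|[|m]] // _ H; set M := m.+2.
pose q l : {poly K} := \poly_(k < m.+1) ((-1) ^+ k * z k.+1 l).
pose p0 : {poly K} := \poly_(k < m.+1) ((-1) ^+ k * c k.+1).
pose D j : {poly K} := \poly_(k < m.+1) ((-1) ^+ k * d j ^+ k.+1).
have DE j : \sum_l al j l *: q l = D j - p0.
  apply/polyP => k; rewrite coefB !coef_poly coef_sum.
  under eq_bigr do rewrite coefZ coef_poly.
  case: ifP => km; last by rewrite subr0 big1 // => l _; rewrite mulr0.
  rewrite -mulrBr H ?addrK; last by rewrite ltnS.
  by rewrite mulr_sumr; apply: eq_bigr => l _; rewrite mulrCA.
have DX j : (1 + d j *: 'X) * D j = (d j)%:P - ((-1) ^+ m.+1 * d j ^+ M) *: 'X^(m.+1).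
  apply/polyP => k; rewrite mulrDl mul1r -scalerAl.
  rewrite !coefD coefN !coefZ coefXM coefXn coefC !coef_poly.
  case: k => [|k] /=; first by rewrite expr0 mul1r expr1 !mulr0 addr0 subr0.
  rewrite eqSS ltnS; have [km|km|->] := ltngtP k m.
  - by rewrite ltnS (ltnW km) !exprS mulr0; ring.
  - rewrite ltnS leqNgt km /=; ring.
  - by rewrite leqnn !exprS mulr1; ring.
have [x x0 xq] := fin_all_exists2 (fun l => exp_exists M (q l)).
have [u u0 uq] := exp_exists M (- p0).
exists (fun l => x l - 1), u.
have y0 l : (x l - 1)`_0 = 0 by rewrite coefB x0 coefC subrr.
split=> // [l|j].
  have := xq l 0%N isT; rewrite coef_deriv coefM big_ord1 x0 mul1r mulr1n coef_poly /= expr0 mul1r.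
  by rewrite coefB coefC subr0.
apply: (@ode_unique _ _ _ _ (D j - p0)).
- transitivity (1 : K); last first.
    rewrite coefD coefM big_ord1 u0 mul1r !coefD !coefZ coefX coefXn coefC /=.
    by rewrite !mulr0 !addr0.
  rewrite -horner_coef0 horner_prod; apply: big1 => l _.
  rewrite horner_coef0 /binom_trunc big_ord_recl coefD coefZ expr0 coefC mulr1 /gbinom big_ord0.
  rewrite coef_sum big1 ?addr0 // => k _.
  by rewrite coefZ coefX_low ?mulr0.
- rewrite -DE; apply: ode_prod => l; apply: binom_trunc_ode => //.
  by rewrite addrCA subrr addr0 derivB derivC subr0.
set e := (-1) ^+ M / M%:R * d j ^+ M; set L := 1 + d j *: 'X.
have dL : L^`() = (d j)%:P by rewrite derivD derivC derivZ derivX add0r alg_polyC.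
rewrite derivD derivM dL derivZ derivXn.
have eM : e *: ('X^(m.+1) *+ M) = - (((-1) ^+ m.+1 * d j ^+ M) *: 'X^(m.+1)).
  rewrite -scaler_nat scalerA -scaleNr; congr (_ *: _).
  by rewrite /e /M exprS; field; rewrite -[2 + _]natrD pnatr_eq0.
apply: eqX_trans (_ : eqX M (u * - p0 * L + u * (d j)%:P - ((-1) ^+ m.+1 * d j ^+ M) *: 'X^(m.+1)) _).
  rewrite eM; apply: eqXD => //; apply: eqXD => //; exact: eqXM.
apply: eqX_trans (_ : eqX M (u * - p0 * L + u * (d j)%:P - ((-1) ^+ m.+1 * d j ^+ M) *: ('X^(m.+1) * u)) _).
  apply: eqXD => //; apply: eqXN; apply: eqXZ => i iM.
  rewrite coefXnM coefXn; case: (ltngtP i m.+1) => [//||->]; last by rewrite subnn u0.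
  by rewrite ltnNge -ltnS iM.
have -> : (u * L + e *: 'X^M) * (D j - p0) = (u * - p0 * L + u * (L * D j)) + 'X^M * (e *: (D j - p0)).
  by rewrite -!mul_polyC; ring.
rewrite DX -[X in eqX _ X _]addr0; apply: eqXD; last exact/eqX_sym/eqX_mulXn.
have -> : u * ((d j)%:P - ((-1) ^+ m.+1 * d j ^+ M) *: 'X^(m.+1)) =
  u * (d j)%:P - ((-1) ^+ m.+1 * d j ^+ M) *: ('X^(m.+1) * u).
  by rewrite -!mul_polyC; ring.
by rewrite addrA; exact: eqX_refl.
Qed.

End Curve.

(** * Binomial series and evaluation along a curve *)

Section Subst.
Local Open Scope complex_scope.
Variables (R : realType) (n : nat).
Local Notation idx := (@mindex n).
Local Notation K := R[i].
Local Notation O := (@cps R n).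
Local Notation C_ := (@cps_const R n).

Lemma big_boxes_prod (A : comPzRingType) (a : 'I_n -> nat -> A) N :
  \sum_(k <- boxes n N) \prod_l a l (k l) = \prod_l \sum_(j < N) a l j.
Proof.
rewrite bigA_distr_bigA -big_boxes; apply: eq_bigr => k _.
by apply: eq_bigr => l _; rewrite ffunE.
Qed.

Lemma convergent_geometric (f : @Defs.pseries R n) (B : K) : 0 <= B ->
  (forall k, `|f k| <= B ^+ deg k) -> convergent f.
Proof.
move=> B0 H; have B1 : 0 < B + 1 by rewrite ltr_wpDl.
have r0 : 0 < (2 * (B + 1))^-1 by rewrite invr_gt0 mulr_gt0.
apply/convergentP; exists (2 * (B + 1))^-1, (2 ^+ n); split=> // N.
apply: le_trans (_ : \sum_(k <- boxes n N) \prod_(l < n) (2^-1 : K) ^+ k l <= _).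
  apply: ler_sum => k _; rewrite prodrXr -/(deg k).
  apply: le_trans (ler_wpM2r (exprn_ge0 _ (ltW r0)) (H k)) _.
  rewrite -exprMn lerXn2r ?nnegrE ?(mulr_ge0 B0 (ltW r0)) ?invr_ge0 //.
  by rewrite invfM mulrCA ler_piMr ?invr_ge0 // ler_pdivrMr // mul1r lerDl.
rewrite (big_boxes_prod (fun _ j => (2^-1 : K) ^+ j)) prodr_const card_ord.
by rewrite lerXn2r ?nnegrE ?geo2 // sumr_ge0 // => j _; rewrite exprn_ge0 // invr_ge0.
Qed.

Definition binom_ser (al : 'I_n -> K) : @Defs.pseries R n :=
  fun k => \prod_l gbinom (al l) (k l).

Lemma convergent_binom al : convergent (binom_ser al).
Proof.
pose B := \sum_l (`|al l| + 1).
have Bl l : `|al l| + 1 <= B.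
  by rewrite /B (bigD1 l) //= lerDl sumr_ge0 // => j _; rewrite addr_ge0.
apply: (@convergent_geometric _ B) => [|k].
  by rewrite sumr_ge0 // => j _; rewrite addr_ge0.
rewrite normr_prod /deg -prodrXr; apply: ler_prod => l _.
rewrite normr_ge0 (le_trans (gbinom_bound _ _)) // lerXn2r ?nnegrE ?addr_ge0 //.
by rewrite (le_trans _ (Bl l)) // addr_ge0.
Qed.

Definition binom_cps al : O := Cps (convergent_binom al).

Section Phi.
Variables (y : 'I_n -> {poly K}) (M : nat).
Hypothesis y0 : forall l, (y l)`_0 = 0.

(** The value of f on the curve y, as a sum over a box: since the curve starts
    at the origin, the other terms vanish modulo the M-th power of the
    variable. *)
Definition ceval (f : O) : {poly K} := \sum_(k <- boxes n M) cf f k *: mono y k.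

Lemma cevalD f g : ceval (f + g) = ceval f + ceval g.
Proof. by rewrite -big_split; apply: eq_bigr => k _; rewrite cfD scalerDl. Qed.

Lemma ceval0 : ceval 0 = 0.
Proof. by rewrite /ceval big1 // => k _; rewrite cf0 scale0r. Qed.

Lemma ceval_sum (I : Type) (t : seq I) (P : pred I) (F : I -> O) :
  ceval (\sum_(i <- t | P i) F i) = \sum_(i <- t | P i) ceval (F i).
Proof. by apply: (big_morph ceval); [exact: cevalD|exact: ceval0]. Qed.

Lemma ceval_constM c f : ceval (C_ c * f) = c *: ceval f.
Proof.
by rewrite scaler_sumr; apply: eq_bigr => k _; rewrite cf_constM scalerA.
Qed.

Lemma mono_high N k : k \notin boxes n N -> eqX N (mono y k) 0.
Proof.
rewrite mem_boxes negb_forall => /existsP[l]; rewrite -leqNgt => kl i iN.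
rewrite /mono (bigD1 l) //= coefM big1 ?coef0 // => j _.
by rewrite coefX_low ?mul0r // (leq_trans _ kl) // (leq_trans _ iN) // ltnS.
Qed.

(** Only the products of monomials that leave the box are lost, and these are
    multiples of the M-th power of the variable. *)
Lemma cevalM f g : eqX M (ceval (f * g)) (ceval f * ceval g).
Proof.
have -> : ceval f * ceval g = \sum_(p <- boxes n M) \sum_(q <- boxes n M)
    (cf f p * cf g q) *: mono y (p + q).
  rewrite /ceval mulr_suml; apply: eq_bigr => p _.
  rewrite mulr_sumr; apply: eq_bigr => q _.
  by rewrite monoD -scalerAr -scalerAl scalerA mulrC.
have -> : ceval (f * g) = \sum_(p <- boxes n M) \sum_(q <- boxes n M)
    ((cf f p * cf g q) *: mono y (p + q)) *+ (p + q \in boxes n M).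
  rewrite /ceval.
  transitivity (\sum_(k <- boxes n M) \sum_(p <- boxes n M) \sum_(q <- boxes n M)
     ((cf f p * cf g q) *: mono y k) *+ (p + q == k)).
    rewrite big_seq [RHS]big_seq; apply: eq_bigr => k kM.
    rewrite cfM (pmulE _ _ kM) scaler_suml; apply: eq_bigr => p _.
    by rewrite scaler_suml; apply: eq_bigr => q _; rewrite scalerMnl.
  rewrite exchange_big; apply: eq_bigr => p _ /=.
  by rewrite exchange_big; apply: eq_bigr => q _ /=; rewrite big_boxes_delta.
apply: eqX_sum => p _; apply: eqX_sum => q _; have [_|h] := boolP (_ \in _).
  exact: eqX_refl.
by rewrite -[X in eqX _ X _](scaler0 _ (cf f p * cf g q)); apply/eqXZ/eqX_sym/mono_high.
Qed.

Lemma coef0_ceval f : (0 < M)%N -> (ceval f)`_0 = cst0 f.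
Proof.
move=> M0; rewrite coef_sum.
transitivity (\sum_(k <- boxes n M) cf f k *+ (0 == k)).
  apply: eq_bigr => k _; rewrite coefZ -horner_coef0 horner_prod.
  under eq_bigr do rewrite horner_exp horner_coef0 y0.
  case: eqP => [<-|/eqP k0].
    by rewrite big1 ?mulr1 // => l _; rewrite ffunE expr0.
  have [l kl] : exists l, k l != 0%N.
    apply/existsP; apply: contraNT k0 => /existsPn h; apply/eqP/ffunP => l.
    by rewrite ffunE; apply/esym/eqP; have := h l; rewrite negbK.
  by rewrite (bigD1 l) //= expr0n (negbTE kl) mul0r mulr0.
by rewrite big_boxes_delta boxes_deg ?mulr1n // deg0.
Qed.

Lemma ceval_const c : (0 < M)%N -> ceval (C_ c) = c%:P.
Proof.
move=> M0; transitivity (\sum_(k <- boxes n M) (c *: mono y k) *+ (0 == k)).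
  by apply: eq_bigr => k _; rewrite /= /pconst eq_sym scalerMnl.
by rewrite big_boxes_delta boxes_deg ?deg0 // mono0 alg_polyC.
Qed.

Lemma ceval_var l : (1 < M)%N -> ceval (@var R n l) = y l.
Proof.
move=> M1; transitivity (\sum_(k <- boxes n M) (mono y k) *+ (unit_idx l == k)).
  by apply: eq_bigr => k _; rewrite /= eq_sym scaler_nat.
rewrite big_boxes_delta boxes_deg ?deg_unit // mulr1n /mono (bigD1 l) //= ffunE eqxx expr1.
rewrite big1 ?mulr1 // => j jl; by rewrite ffunE (negbTE jl) expr0.
Qed.

Lemma cevalX f k : (0 < M)%N -> eqX M (ceval (f ^+ k)) (ceval f ^+ k).
Proof.
move=> M0; elim: k => [|k IH].
  by rewrite !expr0 -(rmorph1 C_) ceval_const.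
by rewrite !exprS; apply: eqX_trans (cevalM _ _) _; apply: eqXM.
Qed.

Lemma ceval_binom al : ceval (binom_cps al) = \prod_l binom_trunc (al l) M (y l).
Proof.
rewrite /binom_trunc -(big_boxes_prod (fun l j => gbinom (al l) j *: y l ^+ j)).
by apply: eq_bigr => k _; rewrite /= /binom_ser /mono scaler_prod.
Qed.

End Phi.
End Subst.

(** * A basis of the quotient *)

Section LocalAlgebra.
Local Open Scope complex_scope.
Variables (R : realType) (n : nat).
Local Notation K := R[i].
Local Notation O := (@cps R n).
Local Notation C_ := (@cps_const R n).
Local Notation Y := (@var R n).

Definition linform (om : 'rV[K]_n) : O := \sum_l C_ (om 0 l) * Y l.

Lemma cst0_linform om : cst0 (linform om) = 0.
Proof.
rewrite cst0_sum big1 // => l _; by rewrite cst0M cst0_var mulr0.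
Qed.

Lemma cf_linform om l : cf (linform om) (unit_idx l) = om 0 l.
Proof.
rewrite cf_sum; under eq_bigr do rewrite cf_cst0M_var cst0_const.
rewrite (bigD1 l) //= eqxx mulr1 big1 ?addr0 // => j /negbTE->; exact: mulr0.
Qed.

Variables (F : 'I_n -> O) (m : nat) (y : 'I_n -> {poly K}) (ka : 'cV[K]_n) (om : 'rV[K]_n).
Hypothesis m1 : (1 < m)%N.
Hypothesis y0 : forall l, (y l)`_0 = 0.
Hypothesis Fy : forall i, eqX m.+1 (ceval y m.+1 (F i)) (ka i 0 *: 'X^m).
Hypothesis omy : \sum_l om 0 l * (y l)`_1 != 0.

Let w := linform om.
Let ph := ceval y m.+1.

Lemma ceval_w : ph w = \sum_l om 0 l *: y l.
Proof.
rewrite /ph ceval_sum; apply: eq_bigr => l _.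
by rewrite ceval_constM ceval_var // ltnS ltnW.
Qed.

Lemma ceval_w0 : (ph w)`_0 = 0.
Proof. by rewrite coef0_ceval // cst0_linform. Qed.

Lemma ceval_w1 : (ph w)`_1 != 0.
Proof.
rewrite ceval_w coef_sum; move: omy; congr (_ != _).
by apply: eq_bigr => l _; rewrite coefZ.
Qed.

Lemma ceval_inI h : inI F h -> eqX m (ph h) 0.
Proof.
move=> [g ->]; rewrite /ph ceval_sum.
elim/big_ind: _ => [//|p q hp hq|i _]; first by rewrite -[X in eqX _ _ X]addr0; exact: eqXD.
apply: eqX_trans (eqXW (leqnSn m) (cevalM y0 _ _)) _.
apply: eqX_trans (eqXM (@eqX_refl _ _ _) (eqXW (leqnSn m) (Fy i))) _.
by rewrite -scalerAr -['X^m]mulr1 mulrCA scalerAr; exact: eqX_mulXn.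
Qed.

Lemma ceval_lin (u : 'rV_m) : eqX m.+1 (ph (lin (@pow R n w m) u)) (\sum_(k < m) u 0 k *: ph w ^+ k).
Proof.
rewrite /ph ceval_sum; apply: eqX_sum => k _; rewrite ceval_constM; apply: eqXZ.
exact: cevalX.
Qed.

(** The ideal vanishes on the curve modulo the m-th power of the parameter,
    whereas w vanishes to order exactly 1, so that a relation between its
    powers is a triangular system. *)
Lemma indep_pow : indep F (@pow R n w m).
Proof.
move=> u hu; apply/rowP => k; rewrite mxE.
apply: (@triangular_vanish _ _ (fun k => u 0 k) (ph w) m ceval_w0 ceval_w1) => //.
apply: eqX_trans (eqX_sym (eqXW (leqnSn m) (ceval_lin u))) _.
exact: ceval_inI.
Qed.

Hypothesis F0 : forall i, cst0 (F i) = 0.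
Hypothesis Junit : jac F + ka *m om \in unitmx.
Variable be : 'rV[K]_n.
Hypothesis beJ : be *m jac F = 0.
Hypothesis beka : (be *m ka) 0 0 != 0.

Let G i := F i + C_ (ka i 0) * w.

Lemma varG l : exists v : 'I_n -> O, Y l = \sum_i v i * G i.
Proof.
apply: nakayama => [i|].
  by rewrite cst0D F0 add0r cst0M cst0_linform mulr0.
suff -> : jac G = jac F + ka *m om by [].
apply/matrixP => i j; rewrite !mxE big_ord1 cfD cf_constM.
by rewrite cf_linform.
Qed.

Lemma max_w h : exists g, inI F (h - C_ (cst0 h) - g * w).
Proof.
have [g Hg] := inI_max varG h.
exists (\sum_i g i * C_ (ka i 0)); exists g; rewrite Hg mulr_suml -sumrB.
by apply: eq_bigr => i _; rewrite /G; ring.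
Qed.

(** The combination sum_i be_i F_i has no linear part, so it is a combination
    of the variables with coefficients in the maximal ideal. Replacing the
    variables by combinations of F_i + ka_i w collects a multiple s w of w, up
    to combinations of the F_i with coefficients in the maximal ideal. *)
Lemma exists_sw : exists s a, [/\ s * w = \sum_i (C_ (be 0 i) - a i) * F i &
  forall i, cst0 (a i) = 0].
Proof.
pose Fb := \sum_i C_ (be 0 i) * F i.
have Fb0 : cst0 Fb = 0.
  by rewrite cst0_sum big1 // => i _; rewrite cst0M F0 mulr0.
have [h Hh] := hadamard Fb0.
have h0 l : cst0 (h l) = 0.
  transitivity (cf Fb (unit_idx l)).
    rewrite Hh cf_sum; under eq_bigr do rewrite cf_cst0M_var.
    rewrite (bigD1 l) //= eqxx mulr1 big1 ?addr0 // => j /negbTE->; exact: mulr0.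
  rewrite cf_sum; under eq_bigr do rewrite cf_constM.
  have := congr1 (fun A : 'rV_n => A 0 l) beJ; rewrite !mxE => e; rewrite -[RHS]e.
  by apply: eq_bigr => i _; rewrite mxE.
have [V HV] := fin_all_exists varG.
exists (\sum_i (\sum_l h l * V l i) * C_ (ka i 0)), (fun i => \sum_l h l * V l i).
split=> [|i]; last first.
  by rewrite cst0_sum big1 // => l _; rewrite cst0M h0 mul0r.
under [RHS]eq_bigr do rewrite mulrBl.
rewrite sumrB -/Fb Hh.
have -> : \sum_i h i * Y i = \sum_i (\sum_l h l * V l i) * G i.
  under [RHS]eq_bigr do rewrite mulr_suml.
  rewrite exchange_big; apply: eq_bigr => l _ /=.
  by rewrite {1}HV mulr_sumr; apply: eq_bigr => i _; rewrite mulrA.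
rewrite -sumrB mulr_suml; apply: eq_bigr => i _; rewrite /G; ring.
Qed.

(** On the curve, s w has order exactly m by [exists_sw], hence s has order m
    - 1. In the expansion of s in powers of w this forces the terms of degree
    below m - 1 to vanish and the coefficient of w^(m-1) to be non-zero, so s
    w is w^m times a unit, up to the ideal. *)
Lemma pow_w_in : inI F (w ^+ m).
Proof.
have [s [a [sw a0]]] := exists_sw.
have swI : inI F (s * w) by exists (fun i => C_ (be 0 i) - a i).
have [u [g H]] := pow_expansion max_w m s.
set j := s - _ - _ in H.
have sE : s = lin (@pow R n w m) u + g * w ^+ m + j by rewrite /j; ring.
have phw : exists q, ph w = 'X * q.
  have [|q ->] := @eqX0P _ 1 (ph w); last by exists q.
  by case=> // _; rewrite ceval_w0 coef0.
have [q Hq] := phw.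
pose c := (be *m ka) 0 0.
have E1 : eqX m.+1 (ph (s * w)) (c *: 'X^m).
  rewrite sw /ph ceval_sum /c mxE scaler_suml; apply: eqX_sum => i _.
  apply: eqX_trans (cevalM y0 _ _) _.
  apply: eqX_trans (eqXM (@eqX_refl _ _ _) (Fy i)) _.
  have [r Hr] : exists r, ceval y m.+1 (C_ (be 0 i) - a i) = (be 0 i)%:P + 'X * r.
    have [|r Hr] := @eqX0P _ 1 (ceval y m.+1 (C_ (be 0 i) - a i) - (be 0 i)%:P); last first.
      by exists r; rewrite -[LHS](subrK (be 0 i)%:P) Hr addrC.
    case=> // _; rewrite coefB coef0_ceval // cst0B a0 cst0_const subr0 coefC.
    by rewrite subrr coef0.
  rewrite Hr mulrDl -[X in eqX _ _ X]addr0; apply: eqXD.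
    by rewrite mul_polyC scalerA; exact: eqX_refl.
  rewrite -mul_polyC.
  have -> : 'X * r * ((ka i 0)%:P * 'X^m) = 'X^(m.+1) * (r * (ka i 0)%:P).
    by rewrite exprS; ring.
  exact: eqX_mulXn.
have E2 : eqX m.+1 (ph (s * w)) ((\sum_(k < m) u 0 k *: ph w ^+ k) * ph w).
  apply: eqX_trans (cevalM y0 _ _) _; rewrite -/ph.
  have -> : ph s = ph (lin (@pow R n w m) u) + ph (g * w ^+ m) + ph j.
    by rewrite {1}sE /ph !cevalD.
  rewrite Hq mulrDl mulrDl -[X in eqX _ _ X]addr0.
  apply: eqXD; last first.
    have [r ->] := eqX0P (ceval_inI H).
    have -> : 'X^m * r * ('X * q) = 'X^(m.+1) * (r * q) by rewrite exprS; ring.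
    exact: eqX_mulXn.
  rewrite -[X in eqX _ _ X]addr0; apply: eqXD.
    by apply: eqXM => //; rewrite -Hq; exact: ceval_lin.
  apply: eqX_trans (eqXM (cevalM y0 _ _) (@eqX_refl _ _ _)) _.
  apply: eqX_trans (eqXM (eqXM (@eqX_refl _ _ _) (cevalX y0 _ _ (ltn0Sn m))) (@eqX_refl _ _ _)) _.
  rewrite -/ph Hq exprMn.
  have -> : ph g * ('X^m * q ^+ m) * ('X * q) = 'X^(m.+1) * (ph g * q ^+ m * q) by rewrite exprS; ring.
  exact: eqX_mulXn.
set S := \sum_(k < m) u 0 k *: ph w ^+ k in E2.
have mE : m.-1.+1 = m := prednK (ltnW m1).
have E3 : eqX m (q * S) (c *: 'X^(m.-1)).
  move=> i im; have := eqX_trans (eqX_sym E2) E1; move=> /(_ i.+1 im).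
  have -> : S * ph w = 'X * (q * S) by rewrite Hq; ring.
  by rewrite coefXM /= => ->; rewrite !coefZ !coefXn -{1}mE eqSS.
have q0 : q`_0 != 0 by have := ceval_w1; rewrite Hq coefXM.
have S0 : eqX m.-1 S 0.
  apply: (eqX_cancel q0) => i im.
  rewrite E3; last by rewrite -mE ltnW.
  by rewrite coefZ coefXn (ltn_eqF im) mulr0 mulr0 coef0.
have u0 (k : 'I_m) : (k < m.-1)%N -> u 0 k = 0.
  exact: (@triangular_vanish _ _ (fun k => u 0 k) _ _ ceval_w0 ceval_w1 S0).
have mm : (m.-1 < m)%N by rewrite mE.
pose k0 := Ordinal mm.
have uk0 : u 0 k0 != 0.
  have := E3 _ mm; rewrite coefZ coefXn eqxx mulr1.
  have [S' SE] := eqX0P S0.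
  have S'0 : S'`_0 = S`_m.-1 by rewrite SE coefXnM ltnn subnn.
  have -> : q * S = 'X^(m.-1) * (q * S') by rewrite SE; ring.
  rewrite coefXnM ltnn subnn coefM big_ord1 S'0.
  have := @coef_triangular _ m (fun k => u 0 k) (ph w) k0 ceval_w0 u0; rewrite -/S /= => ->.
  by move=> e; apply: contraNneq beka => uz; rewrite -/c -e uz mul0r mulr0.
have -> : w ^+ m = w ^+ m.-1 * w by rewrite -{1}mE exprSr.
have sE' : s * w = w ^+ m.-1 * w * (C_ (u 0 k0) + g * w) + j * w.
  rewrite {1}sE /lin (bigD1 k0) //= big1 => [|k kk0]; last first.
    rewrite u0 ?rmorph0 ?mul0r // ltn_neqAle -ltnS mE ltn_ord andbT.
    by apply: contra kk0 => /eqP e; apply/eqP/val_inj.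
  by rewrite /pow /= -[in w ^+ m]mE exprS; ring.
have [v Hv] : exists v, (C_ (u 0 k0) + g * w) * v = 1.
  by apply: cps_unit; rewrite cst0D cst0M cst0_linform mulr0 addr0 cst0_const.
have -> : w ^+ m.-1 * w = v * (s * w - w * j).
  by rewrite sE' -[LHS]mulr1 -Hv; ring.
by apply/inIM/inIB => //; exact: inIM.
Qed.

Lemma spans_w : spans F (@pow R n w m).
Proof. by apply: spans_pow; [exact: max_w|exact: pow_w_in]. Qed.

End LocalAlgebra.

(** * Convergence of the binomial series to the principal power *)

Section RealSeries.
Local Open Scope classical_set_scope.
Variable R : realType.
Implicit Types (c : R^nat) (t : R).

(** Differentiation of a series with geometric coefficients doubles the ratio
    at most, because k + 1 <= 2^k. Starting from the ratio 1/16 this leaves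
    enough room for the two derivatives needed by termwise differentiation at
    every point of modulus less than 2. *)
Lemma diffs_bound c (q : R) : 0 <= q <= 1 -> (forall k, `|c k| <= q ^+ k) ->
  forall k, `|pseries_diffs c k| <= (2 * q) ^+ k.
Proof.
move=> /andP[q0 q1] cq k; rewrite normrM normr_nat exprMn.
apply: ler_pM => //.
  by rewrite -natrX ler_nat ltn_expl.
by apply: le_trans (cq _) _; rewrite exprS ler_piMl // exprn_ge0.
Qed.

Lemma cvg_pseries_quarter c : (forall k, `|c k| <= 4^-1 ^+ k) ->
  cvgn (pseries c 2).
Proof.
move=> cq; apply: normed_cvg.
apply: (@series_le_cvg _ _ (geometric 1 2^-1)) => [||k|] //=.
- rewrite mul1r normrM normrX [`|2|]ger0_norm //.
  apply: le_trans (ler_wpM2r _ (cq k)) _; first exact: exprn_ge0.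
  by rewrite -exprMn lerXn2r ?nnegrE //; lra.
- by apply: is_cvg_geometric_series; rewrite ger0_norm; lra.
Qed.

Lemma is_derive_pseries c : (forall k, `|c k| <= 16^-1 ^+ k) ->
  forall t, `|t| < 2 ->
  [/\ cvgn (pseries c t), cvgn (pseries (pseries_diffs c) t) &
   is_derive t 1 (fun t => limn (pseries c t)) (limn (pseries (pseries_diffs c) t))].
Proof.
move=> cq t t2.
have dc : forall k, `|pseries_diffs c k| <= 8^-1 ^+ k.
  move=> k; rewrite (_ : 8^-1 = 2 * 16^-1 :> R); last by lra.
  by apply: diffs_bound => //; lra.
have ddc : forall k, `|pseries_diffs (pseries_diffs c) k| <= 4^-1 ^+ k.
  move=> k; rewrite (_ : 4^-1 = 2 * 8^-1 :> R); last by lra.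
  by apply: diffs_bound => //; lra.
have t2' : `|t| < `|2| :> R by rewrite [ltRHS]ger0_norm.
have C0 : cvgn (pseries c 2).
  apply: cvg_pseries_quarter => k; apply: le_trans (cq k) _.
  by rewrite lerXn2r ?nnegrE //; lra.
have C1 : cvgn (pseries (pseries_diffs c) 2).
  apply: cvg_pseries_quarter => k; apply: le_trans (dc k) _.
  by rewrite lerXn2r ?nnegrE //; lra.
have C2 := cvg_pseries_quarter ddc.
split; [exact: is_cvg_pseries_inside C0 _|exact: is_cvg_pseries_inside C1 _|].
exact: pseries_snd_diffs C0 C1 C2 _.
Qed.

End RealSeries.

Section Ray.
Local Open Scope classical_set_scope.
Variable R : realType.
Variables (al u v : R).
Implicit Types t : R.

(** The modulus of 1 + y t with y = u + i v, its logarithm, and the argument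
    of 1 + y t, in the form used by [clog]. *)
Let rho t := Num.sqrt ((1 + u * t) ^+ 2 + (v * t) ^+ 2).
Let L t := ln (rho t).
Let A t := 2 * atan (v * t / (rho t + (1 + u * t))).

Lemma ray_sq_gt0 t : 0 < 1 + u * t -> 0 < (1 + u * t) ^+ 2 + (v * t) ^+ 2.
Proof. by move=> h; rewrite ltr_pwDl ?sqr_ge0 // exprn_gt0. Qed.

Lemma is_derive_lin t : is_derive t 1 (fun t => v * t) v.
Proof.
have := @is_deriveZ _ _ _ _ v _ _ _ (is_derive_id t 1).
by move=> /is_derive_eq; apply; rewrite /GRing.scale /= mulr1.
Qed.

Lemma is_derive_affine t : is_derive t 1 (fun t => 1 + u * t) u.
Proof.
have := @is_deriveZ _ _ _ _ u _ _ _ (is_derive_id t 1).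
move=> /(is_deriveD (is_derive_cst (1 : R) t 1)).
by move=> /is_derive_eq; apply; rewrite add0r /GRing.scale /= mulr1.
Qed.

Lemma is_derive_rho t : 0 < 1 + u * t ->
  is_derive t 1 rho (((1 + u * t) * u + v ^+ 2 * t) / rho t).
Proof.
move=> h; have s0 := ray_sq_gt0 h.
have r0 : 0 < rho t by rewrite sqrtr_gt0.
have D : is_derive t 1 (fun t => (1 + u * t) ^+ 2 + (v * t) ^+ 2)
   (2 * ((1 + u * t) * u + v ^+ 2 * t)).
  have D1 := is_derive_affine t.
  have D2 := is_derive_lin t.
  have := is_deriveD (@is_deriveX _ _ _ 2 _ _ _ D1) (@is_deriveX _ _ _ 2 _ _ _ D2).
  move=> /is_derive_eq; apply.
  rewrite /GRing.scale /=; ring.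
have := @is_derive1_comp _ Num.sqrt _ t _ _ (is_derive1_sqrt s0) D.
move=> /is_derive_eq; apply; rewrite -/(rho t); field; exact: lt0r_neq0.
Qed.

Lemma is_derive_L t : 0 < 1 + u * t ->
  is_derive t 1 L (((1 + u * t) * u + v ^+ 2 * t) / rho t ^+ 2).
Proof.
move=> h; have s0 := ray_sq_gt0 h.
have r0 : 0 < rho t by rewrite sqrtr_gt0.
have := @is_derive1_comp _ _ _ t _ _ (is_derive1_ln r0) (is_derive_rho h).
move=> /is_derive_eq; apply; field; exact: lt0r_neq0.
Qed.

Lemma is_derive_A t : 0 < 1 + u * t -> is_derive t 1 A (v / rho t ^+ 2).
Proof.
move=> h; have s0 := ray_sq_gt0 h.
have r0 : 0 < rho t by rewrite sqrtr_gt0.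
have re : rho t ^+ 2 = (1 + u * t) ^+ 2 + (v * t) ^+ 2 by rewrite sqr_sqrtr // ltW.
have d0 : rho t + (1 + u * t) != 0 by rewrite lt0r_neq0 // addr_gt0.
have D1 := is_derive_affine t.
have D2 := is_deriveD (is_derive_rho h) D1.
have D3 := @is_deriveV _ (rho + (fun t => 1 + u * t)) t _ _ d0 D2.
have D4 := is_derive_lin t.
have D5 := is_deriveM D4 D3.
have D6 := @is_derive1_comp _ _ _ t _ _ (is_derive1_atan _) D5.
have D7 := @is_deriveZ _ _ _ _ 2 _ _ _ D6.
move: D7 => /is_derive_eq; apply.
rewrite !fctE /= /GRing.scale /=.
have n0 := lt0r_neq0 r0.
have e1 : 1 + (v * t / (rho t + (1 + u * t))) ^+ 2 =
   2 * rho t / (rho t + (1 + u * t)).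
  have -> : 1 + (v * t / (rho t + (1 + u * t))) ^+ 2 =
    (rho t ^+ 2 + 2 * rho t * (1 + u * t) + ((1 + u * t) ^+ 2 + (v * t) ^+ 2)) /
    (rho t + (1 + u * t)) ^+ 2 by field.
  rewrite -re; by field.
rewrite e1; set r := rho t in re d0 n0 *.
have e2 : v ^+ 2 * t ^+ 2 = r ^+ 2 - (1 + u * t) ^+ 2 by rewrite re; ring.
apply: (mulfI (expf_neq0 2 n0)); apply: (mulfI d0).
transitivity ((r + (1 + u * t)) * v * r - v * t * ((1 + u * t) * u + r * u)  - v * (v ^+ 2 * t ^+ 2)).
  field. by rewrite n0 d0.
rewrite e2; field. by rewrite n0.
Qed.

Variables P Q : R^nat.
Hypothesis P0 : P 0%N = 1.
Hypothesis Q0 : Q 0%N = 0.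
Hypothesis PS : forall k, k.+1%:R * P k.+1 = (al - k%:R) * (u * P k - v * Q k).
Hypothesis QS : forall k, k.+1%:R * Q k.+1 = (al - k%:R) * (u * Q k + v * P k).
Hypothesis Pb : forall k, `|P k| <= 16^-1 ^+ k.
Hypothesis Qb : forall k, `|Q k| <= 16^-1 ^+ k.
Hypothesis u2 : `|u| <= 2^-1.

Let p t := limn (pseries P t).
Let q t := limn (pseries Q t).
Let p' t := limn (pseries (pseries_diffs P) t).
Let q' t := limn (pseries (pseries_diffs Q) t).

(** The equation (1 + y t) S' = al y S of the binomial series, separated into
    its real and imaginary parts: b is the real part of y, and c is plus or
    minus its imaginary part. *)
Lemma pseries_ode (S T : R^nat) (b c t : R) :
  (forall k, `|S k| <= 16^-1 ^+ k) -> (forall k, `|T k| <= 16^-1 ^+ k) ->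
  `|t| < 2 ->
  (forall k, k.+1%:R * S k.+1 = (al - k%:R) * (b * S k + c * T k)) ->
  limn (pseries (pseries_diffs S) t) =
   al * (b * limn (pseries S t) + c * limn (pseries T t)) -
   t * (b * limn (pseries (pseries_diffs S) t) +
        c * limn (pseries (pseries_diffs T) t)).
Proof.
move=> Sb Tb t2 rec.
have [cS cdS _] := is_derive_pseries Sb t2.
have [cT cdT _] := is_derive_pseries Tb t2.
have eS := pseries_diffs_equiv cdS; have eT := pseries_diffs_equiv cdT.
apply: cvg_lim => //.
apply: cvg_trans (cvgB (cvgM (cvg_cst (al : R)) (cvgD (cvgM (cvg_cst (b : R)) cS) (cvgM (cvg_cst (c : R)) cT)))
  (cvgM (cvg_cst (t : R)) (cvgD (cvgM (cvg_cst (b : R)) eS) (cvgM (cvg_cst (c : R)) eT)))).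
apply: near_eq_cvg; apply: nearW => N.
rewrite !fctE /= /pseries /series /=.
rewrite !mulr_sumr -!big_split /= !mulr_sumr -sumrB; apply: eq_bigr => k _.
rewrite /pseries_diffs rec.
case: k => [|k] /=; first by rewrite !expr0; ring.
by rewrite exprS; ring.
Qed.

(** Here P and Q are the real and imaginary parts of the coefficients of the
    binomial series along the segment from 1 to 1 + y, with y = u + i v. The
    quotient of its sum by the principal power, whose parts are H1 and H2, has
    derivative 0 on the segment and is 1 at t = 0. *)
Lemma binomial_ray :
  p 1 = expR (al * L 1) * cos (al * A 1) /\ q 1 = expR (al * L 1) * sin (al * A 1).
Proof.
have pos t : `|t| < 2 -> 0 < 1 + u * t.
  move=> t2; have : `|u * t| < 1.
    rewrite normrM; apply: le_lt_trans (_ : 2^-1 * `|t| < 1); last by lra.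
    exact: ler_wpM2r.
  by rewrite ltr_norml => /andP[]; lra.
pose E t := expR (- al * L t).
pose th t := al * A t.
pose H1 := E * (p * (cos \o th) + q * (sin \o th)).
pose H2 := E * (q * (cos \o th) - p * (sin \o th)).
have D t : `|t| < 2 -> is_derive t 1 H1 0 /\ is_derive t 1 H2 0.
  move=> t2; have h := pos t t2.
  have s0 := ray_sq_gt0 h.
  have re : rho t ^+ 2 = (1 + u * t) ^+ 2 + (v * t) ^+ 2.
    by rewrite sqr_sqrtr // ltW.
  have [_ _ dp] := is_derive_pseries Pb t2.
  have [_ _ dq] := is_derive_pseries Qb t2.
  have dE := @is_derive1_comp _ expR (fun t => - al * L t) t _ _
    (is_derive_expR _) (@is_deriveZ _ _ _ _ (- al) _ _ _ (is_derive_L h)).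
  have dth := @is_deriveZ _ _ _ _ al _ _ _ (is_derive_A h).
  have dc := @is_derive1_comp _ cos th t _ _ (is_derive_cos _) dth.
  have ds := @is_derive1_comp _ sin th t _ _ (is_derive_sin _) dth.
  have o1 := pseries_ode Pb Qb t2 (b := u) (c := - v).
  have o2 := pseries_ode Qb Pb t2 (b := u) (c := v).
  have {}o1 := o1 (fun k => etrans (PS k) (congr1 _ (congr1 _ (esym (mulNr _ _))))).
  have {}o2 := o2 QS.
  rewrite -/(p t) -/(q t) -/(p' t) -/(q' t) in o1 o2 dp dq.
  have s1 : rho t ^+ 2 != 0 by rewrite re lt0r_neq0.
  have a1 : (1 + u * t) * p' t - v * t * q' t = al * (u * p t - v * q t).
    lra.
  have a2 : (1 + u * t) * q' t + v * t * p' t = al * (u * q t + v * p t).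
    lra.
  have op : p' t = al * (((1 + u * t) * u + v ^+ 2 * t) / rho t ^+ 2) * p t
                   - q t * (al * (v / rho t ^+ 2)).
    apply: (mulfI s1); rewrite [in LHS]re.
    transitivity ((1 + u * t) * (al * (u * p t - v * q t)) +
                  v * t * (al * (u * q t + v * p t))); last first.
      by field; rewrite lt0r_neq0 // sqrtr_gt0.
    rewrite -a1 -a2; ring.
  have oq : q' t = al * (((1 + u * t) * u + v ^+ 2 * t) / rho t ^+ 2) * q t
                   + p t * (al * (v / rho t ^+ 2)).
    apply: (mulfI s1); rewrite [in LHS]re.
    transitivity ((1 + u * t) * (al * (u * q t + v * p t)) -
                  v * t * (al * (u * p t - v * q t))); last first.
      by field; rewrite lt0r_neq0 // sqrtr_gt0.
    rewrite -a1 -a2; ring.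
  split.
    have := is_deriveM dE (is_deriveD (is_deriveM dp dc) (is_deriveM dq ds)).
    move=> /is_derive_eq; apply.
    rewrite /= /GRing.scale /=.
    rewrite !fctE /= op oq -/(E t) -/(p t) -/(q t).
    move: (p t : R) (q t : R) (E t) (sin _) (cos _) (_ / rho t ^+ 2) (_ / rho t ^+ 2) => *; ring.
  have := is_deriveM dE (is_deriveB (is_deriveM dq dc) (is_deriveM dp ds)).
  move=> /is_derive_eq; apply.
  rewrite /= /GRing.scale /=.
  rewrite !fctE /= op oq -/(E t) -/(p t) -/(q t).
    move: (p t : R) (q t : R) (E t) (sin _) (cos _) (_ / rho t ^+ 2) (_ / rho t ^+ 2) => *; ring.
have const (H : R -> R) : (forall t, `|t| < 2 -> is_derive t 1 H 0) -> H 1 = H 0.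
  move=> DH; apply/eqP; rewrite -subr_eq0; apply/eqP.
  have [x||c _ ->] := @MVT_segment R H (cst 0) 0 1 ler01; last by rewrite mul0r.
    by rewrite in_itv /= => /andP[x0 x1]; apply: DH; rewrite ger0_norm; lra.
  apply: derivable_within_continuous => x; rewrite in_itv /= => /andP[x0 x1].
  by have [] : is_derive x 1 H 0 by apply: DH; rewrite ger0_norm; lra.
have L0 : L 0 = 0 by rewrite /L /rho !mulr0 addr0 expr1n expr0n addr0 sqrtr1 ln1.
have A0 : A 0 = 0 by rewrite /A !mulr0 mul0r atan0 mulr0.
have lim0 (S : R^nat) : limn (pseries S 0) = S 0%N.
  apply: lim_near_cst => //; near=> m; rewrite /pseries /series /=.
  rewrite -(@prednK m); last by near: m; exact: nbhs_infty_gt.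
  rewrite big_nat_recl // big1 ?addr0 ?expr0 ?mulr1 // => i _.
  by rewrite exprS mul0r mulr0.
have c1 := const H1 (fun t ht => (D t ht).1).
have c2 := const H2 (fun t ht => (D t ht).2).
have p0 : p 0 = 1 by rewrite /p lim0.
have q0 : q 0 = 0 by rewrite /q lim0.
rewrite /H1 !fctE /= /th A0 mulr0 cos0 sin0 p0 q0 mulr0 addr0 mulr1 mulr1 in c1.
rewrite /H2 !fctE /= /th A0 mulr0 cos0 sin0 p0 q0 mulr0 mul0r subr0 mulr0 in c2.
rewrite {2}/E L0 mulr0 expR0 in c1.
have E1 : E 1 = (expR (al * L 1))^-1 by rewrite /E mulNr expRN.
have e0 := expR_gt0 (al * L 1); set e := expR _ in e0 E1 *.
have cs := cos2Dsin2 (al * A 1).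
set x := cos _ in c1 c2 cs *; set y := sin _ in c1 c2 cs *.
have d1 : p 1 * x + q 1 * y = e.
  have := congr1 (fun z => e * z) c1; rewrite E1 mulr1 mulrA divff ?mul1r //.
  exact: lt0r_neq0.
have d2 : q 1 * x - p 1 * y = 0.
  have := congr1 (fun z => e * z) c2; rewrite E1 mulr0 mulrA divff ?mul1r //.
  exact: lt0r_neq0.
move: (p 1 : R) (q 1 : R) d1 d2 => p1 q1 d1 d2.
split.
  rewrite -d1 -[LHS]mulr1 -cs.
  transitivity ((p1 * x + q1 * y) * x - (q1 * x - p1 * y) * y); first by ring.
  by rewrite d2 mul0r subr0.
rewrite -d1 -[LHS]mulr1 -cs.
transitivity ((p1 * x + q1 * y) * y + (q1 * x - p1 * y) * x); first by ring.
by rewrite d2 mul0r addr0.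
Unshelve. all: by end_near. Qed.
End Ray.

Section ComplexBinomial.
Local Open Scope classical_set_scope.
Variable R : realType.
Local Open Scope complex_scope.

Lemma norm_complex_le (x y : R) : `|x +i* y| <= (`|x| + `|y|)%:C.
Proof.
rewrite normc_def lecR /= -[leRHS]ger0_norm ?addr_ge0 // -[leRHS]sqrtr_sqr ler_wsqrtr //.
rewrite sqrrD !real_normK ?num_real // -addrA lerD2l lerDr.
by rewrite mulrn_wge0 // mulr_ge0.
Qed.

Lemma cvg_complex (P Q : R^nat) (p q : R) :
  P @ \oo --> p -> Q @ \oo --> q ->
  ((P N +i* Q N : R[i]^o) @[N --> \oo] --> (p +i* q : R[i]^o)).
Proof.
move=> cP cQ; apply/cvgrPdist_lt => e e0.
have eE : e = (complex.Re e)%:C by rewrite RRe_real // gtr0_real.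
have re0 : 0 < complex.Re e / 2.
  by rewrite divr_gt0 //; rewrite eE ltcR in e0.
move/cvgrPdist_lt: cP => /(_ _ re0) cP; move/cvgrPdist_lt: cQ => /(_ _ re0) cQ.
near=> N.
have hP : `|p - P N| < complex.Re e / 2 by near: N.
have hQ : `|q - Q N| < complex.Re e / 2 by near: N.
have -> : (p +i* q : R[i]^o) - (P N +i* Q N : R[i]^o) = (p - P N) +i* (q - Q N).
  by apply/eqP; rewrite eq_complex /= !eqxx.
apply: le_lt_trans (norm_complex_le _ _) _.
by rewrite eE ltcR (splitr (complex.Re e)) ltrD.
Unshelve. all: by end_near. Qed.

Lemma norm_Im_le (z : R[i]) : `|complex.Im z|%:C <= `|z|.
Proof.
case: z => a b; rewrite normc_def lecR /= -[leLHS]sqrtr_sqr ler_wsqrtr //.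
by rewrite lerDr sqr_ge0.
Qed.

(** The bound on y makes the coefficients of the series smaller than 16^-k, as
    required by [binomial_ray], since generalized binomial coefficients grow
    at most like (|al| + 1)^k. *)
Lemma binomial_series (al : R) (y : R[i]) :
  (`|al|%:C + 1) * `|y| <= 16%:R^-1 ->
  ((\sum_(k < N) gbinom al%:C k * y ^+ k : R[i]^o) @[N --> \oo] -->
    (cexp (al%:C * clog (1 + y)) : R[i]^o)).
Proof.
move=> hy.
pose c k := gbinom al%:C k * y ^+ k.
pose u := complex.Re y; pose v := complex.Im y.
have cS k : k.+1%:R * c k.+1 = (al - k%:R)%:C * (y * c k).
  rewrite /c exprS mulrA gbinomS rmorphB rmorph_nat; ring.
have cb k : `|c k| <= 16%:R^-1 ^+ k.
  rewrite normrM normrX.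
  apply: le_trans (ler_wpM2r _ (gbinom_bound _ _)) _; first exact: exprn_ge0.
  have -> : `|al%:C| = `|al|%:C by rewrite normc_def /= expr0n addr0 sqrtr_sqr.
  rewrite -exprMn lerXn2r // nnegrE; last by rewrite invr_ge0.
  by rewrite mulr_ge0 // addr_ge0 // ler0c.
have e16 : (16%:R^-1 : R[i]) = (16%:R^-1 : R)%:C by rewrite fmorphV rmorph_nat.
have Pb k : `|complex.Re (c k)| <= 16^-1 ^+ k.
  by rewrite -lecR; apply: le_trans (normc_ge_Re _) _; rewrite rmorphXn /= -e16.
have Qb k : `|complex.Im (c k)| <= 16^-1 ^+ k.
  by rewrite -lecR; apply: le_trans (norm_Im_le _) _; rewrite rmorphXn /= -e16.
have yE : y = u +i* v by rewrite /u /v; case: (y).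
have u2 : `|u| <= 2^-1.
  have : `|u|%:C <= 16%:R^-1 :> R[i].
    apply: le_trans (normc_ge_Re _) _; apply: le_trans hy.
    by rewrite mulrDl mul1r lerDr mulr_ge0 // ler0c.
  rewrite e16 lecR; lra.
have PS k : k.+1%:R * complex.Re (c k.+1) =
    (al - k%:R) * (u * complex.Re (c k) - v * complex.Im (c k)).
  have := congr1 (@complex.Re R) (cS k).
  rewrite -[k.+1%:R in X in X = _ -> _](rmorph_nat (real_complex R)) yE.
  case: (c k.+1) => a b; case: (c k) => a' b' /=.
  by rewrite !mul0r !subr0.
have QS k : k.+1%:R * complex.Im (c k.+1) =
    (al - k%:R) * (u * complex.Im (c k) + v * complex.Re (c k)).
  have := congr1 (@complex.Im R) (cS k).
  rewrite -[k.+1%:R in X in X = _ -> _](rmorph_nat (real_complex R)) yE.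
  case: (c k.+1) => a b; case: (c k) => a' b' /=.
  by rewrite !mul0r !addr0 [_ * b' + _]addrC => ->; rewrite addrC.
have P0 : complex.Re (c 0%N) = 1 by rewrite /c /gbinom big_ord0 mul1r.
have Q0 : complex.Im (c 0%N) = 0 by rewrite /c /gbinom big_ord0 mul1r.
have [e1 e2] := binomial_ray P0 Q0 PS QS Pb Qb u2.
have lt12 : `|1 : R| < 2 by rewrite normr1 ltr1n.
have [cP _ _] := is_derive_pseries Pb lt12.
have [cQ _ _] := is_derive_pseries Qb lt12.
rewrite e1 in cP; rewrite e2 in cQ.
have -> : cexp (al%:C * clog (1 + y)) =
   (expR (al * ln (Num.sqrt ((1 + u * 1) ^+ 2 + (v * 1) ^+ 2))) *
   cos (al * (2 * atan (v * 1 / (Num.sqrt ((1 + u * 1) ^+ 2 + (v * 1) ^+ 2) + (1 + u * 1)))))) +i*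
   (expR (al * ln (Num.sqrt ((1 + u * 1) ^+ 2 + (v * 1) ^+ 2))) *
   sin (al * (2 * atan (v * 1 / (Num.sqrt ((1 + u * 1) ^+ 2 + (v * 1) ^+ 2) + (1 + u * 1)))))).
  rewrite yE /cexp /clog /cmod /= !mulr1 !mul0r add0r subr0 addr0.
  by [].
have := cvg_complex cP cQ; apply: cvg_trans; apply: near_eq_cvg.
apply: nearW => N.
have s (S : R^nat) : pseries S 1 N = \sum_(k < N) S k.
  rewrite /pseries /series /= big_mkord.
  by apply: eq_bigr => k _; rewrite expr1n mulr1.
rewrite /= !s.
by apply/eqP; rewrite eq_complex /= !raddf_sum /= !eqxx.
Qed.

End ComplexBinomial.

(** * Expansions of functions: existence and uniqueness *)


Section GenericLimits.
Local Open Scope classical_set_scope.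
Variable K : numFieldType.

Lemma cvg_bigsum (I : Type) (s : seq I) (f : I -> nat -> K) (l : I -> K) :
  (forall i, (f i N : K^o) @[N --> \oo] --> (l i : K^o)) ->
  (\sum_(i <- s) f i N : K^o) @[N --> \oo] --> (\sum_(i <- s) l i : K^o).
Proof.
move=> H; elim: s => [|i s IH].
  rewrite big_nil; under eq_fun do rewrite big_nil; exact: cvg_cst.
rewrite big_cons; under eq_fun do rewrite big_cons.
exact: cvgD (H i) IH.
Qed.

Lemma cvg_bigprod (I : Type) (s : seq I) (f : I -> nat -> K) (l : I -> K) :
  (forall i, (f i N : K^o) @[N --> \oo] --> (l i : K^o)) ->
  (\prod_(i <- s) f i N : K^o) @[N --> \oo] --> (\prod_(i <- s) l i : K^o).
Proof.
move=> H; elim: s => [|i s IH].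
  rewrite big_nil; under eq_fun do rewrite big_nil; exact: cvg_cst.
rewrite big_cons; under eq_fun do rewrite big_cons.
exact: cvgM (H i) IH.
Qed.

Lemma cvg_scale (c : K) (f : nat -> K) (l : K) :
  (f N : K^o) @[N --> \oo] --> (l : K^o) ->
  (c * f N : K^o) @[N --> \oo] --> (c * l : K^o).
Proof. by move=> H; apply: cvgM H; exact: cvg_cst. Qed.

Lemma cvg_dist (f : nat -> K) (l e : K) : 0 < e ->
  (f N : K^o) @[N --> \oo] --> (l : K^o) ->
  exists N0, forall N, (N0 <= N)%N -> `|l - f N| < e.
Proof.
by move=> e0 /cvgrPdist_lt /(_ e e0) [N0 _ H]; exists N0 => N hN; apply: H.
Qed.

End GenericLimits.

Section Expansion.
Local Open Scope classical_set_scope.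
Local Open Scope complex_scope.
Variables (R : realType) (n : nat).
Local Notation K := R[i].
Local Notation ser := (@Defs.pseries R n).

Lemma psum_binom (al : 'I_n -> K) (y : 'cV[K]_n) N :
  psum (binom_ser al) y N = \prod_l \sum_(k < N) gbinom (al l) k * y l 0 ^+ k.
Proof.
rewrite psumE -(big_boxes_prod (fun l k => gbinom (al l) k * y l 0 ^+ k)).
by apply: eq_bigr => k _; rewrite -big_split.
Qed.

Lemma expands_monomial (a : 'cV[R]_n) :
  expands (const_mx 1) (monomial a) (binom_ser (fun l => (a l 0)%:C)).
Proof.
split; first exact: convergent_binom.
pose B := \sum_l (`|a l 0| + 1).
have Bl l : `|a l 0| + 1 <= B.
  by rewrite /B (bigD1 l) //= lerDl sumr_ge0 // => j _; rewrite addr_ge0.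
have B0 : 0 <= B by rewrite sumr_ge0 // => j _; rewrite addr_ge0.
have r0 : 0 < (16%:R * (B + 1))^-1 by rewrite invr_gt0 mulr_gt0 // ltr_wpDl.
exists (16%:R * (B + 1))^-1 => // y hy.
under eq_fun do rewrite psum_binom.
rewrite /monomial; apply: cvg_bigprod => l.
have -> : (const_mx 1 + y) l 0 = 1 + y l 0 by rewrite !mxE.
apply: binomial_series.
apply: le_trans (_ : (B + 1)%:C * ((16%:R * (B + 1))^-1)%:C <= _); last first.
  rewrite -rmorphM /= invfM mulrCA divff ?mulr1 ?lt0r_neq0 ?ltr_wpDl //.
  by rewrite fmorphV rmorph_nat.
apply: ler_pM => //.
- by rewrite addr_ge0 // ler0c.
- rewrite -[1]/(1%:C) -rmorphD lecR (le_trans (Bl l)) // lerDl.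
  exact: ler01.
- by apply: ltW; exact: hy.
Qed.

Lemma psumD (f g : ser) y N : psum (fun k => f k + g k) y N = psum f y N + psum g y N.
Proof. by rewrite -big_split; apply: eq_bigr => k _; rewrite mulrDl. Qed.

Lemma psumZ c (f : ser) y N : psum (fun k => c * f k) y N = c * psum f y N.
Proof. by rewrite mulr_sumr; apply: eq_bigr => k _; rewrite mulrA. Qed.


Lemma expands0 (p : 'cV[K]_n) : expands p (fun=> 0) (fun=> 0 : K).
Proof.
split; first by apply: convergent_finite; exists 0%N.
exists 1 => // y _; under eq_fun do rewrite /psum.
under eq_fun do under eq_bigr do rewrite mul0r.
under eq_fun do rewrite big1_eq.
exact: cvg_cst.
Qed.

Lemma expands_lin p c (f g : 'cV[K]_n -> K) (F G : ser) : expands p f F -> expands p g G ->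
  expands p (fun x => c * f x + g x) (fun k => c * F k + G k).
Proof.
move=> [cF [r r0 HF]] [cG [s s0 HG]]; split.
  rewrite (_ : (fun k => _) = fun k => pmul (pconst c) F k + G k).
    by apply: convergentD => //; apply: convergentM => //; exact: convergent_const.
  by apply/funext => k; rewrite pmul_constl.
exists (Num.min r s) => [|y hy]; first by rewrite lt_min r0.
under eq_fun do rewrite psumD psumZ.
apply: cvgD; [apply: cvg_scale; apply: HF|apply: HG] => i;
  apply: lt_le_trans (hy i) _; by rewrite lecR ge_min lexx ?orbT.
Qed.

Lemma expands_sum (I : Type) (s : seq I) (a : I -> K) (p : 'cV[K]_n)
    (f : I -> 'cV[K]_n -> K) (c : I -> ser) :
  (forall j, expands p (f j) (c j)) ->
  expands p (fun x => \sum_(j <- s) a j * f j x) (fun k => \sum_(j <- s) a j * c j k).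
Proof.
move=> H; elim: s => [|j s IH].
  rewrite (_ : (fun x => _) = fun=> 0); last by apply/funext => x; rewrite big_nil.
  rewrite (_ : (fun k => _) = fun=> 0); last by apply/funext => x; rewrite big_nil.
  exact: expands0.
rewrite (_ : (fun x => _) = fun x => a j * f j x + \sum_(i <- s) a i * f i x); last first.
  by apply/funext => x; rewrite big_cons.
rewrite (_ : (fun k => _) = fun k => a j * c j k + \sum_(i <- s) a i * c i k); last first.
  by apply/funext => x; rewrite big_cons.
exact: (expands_lin (a j) (H j) IH).
Qed.

(** A combination of evaluations at the points 1/(q+1) that extracts the
    coefficient of degree k0 from polynomials of degree at most m; its
    coefficients solve a Vandermonde system. The points are at most 1, so that
    the monomials of higher degree stay bounded on them. *)
Lemma dual_points m k0 : (k0 <= m)%N ->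
  exists la : 'I_m.+1 -> K, forall k, (k <= m)%N ->
    \sum_q la q * (q.+1%:R^-1) ^+ k = (k == k0)%:R.
Proof.
move=> k0m; pose v : 'rV[K]_m.+1 := \row_q q.+1%:R^-1.
have Vu : Vandermonde m.+1 v \in unitmx.
  rewrite unitmxE unitfE det_Vandermonde; apply/prodf_neq0 => i _.
  apply/prodf_neq0 => j ij; rewrite !mxE subr_eq0 (inj_eq invr_inj) eqr_nat eqSS.
  by rewrite eq_sym neq_ltn ij.
pose la : 'cV[K]_m.+1 := invmx (Vandermonde m.+1 v) *m delta_mx (inord k0) 0.
exists (fun q => la q 0) => k km.
have := congr1 (fun A : 'cV[K]_m.+1 => A (inord k) 0) (mulKVmx Vu (delta_mx (inord k0) 0)).
rewrite !mxE -/la => e.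
have -> : (k == k0) = (inord k == inord k0 :> 'I_m.+1) by rewrite -val_eqE /= !inordK.
rewrite andbT in e; rewrite -e; apply: eq_bigr => q _.
by rewrite !mxE inordK // mulrC.
Qed.

(** By induction on the degree m of k0, assume that all coefficients of lower
    degree vanish. Combining the values of the series at the points with
    coordinates s t / (q + 1), as in [dual_points] for each variable, leaves
    c_k0 as the only term of degree m, and the terms of higher degree are
    O(t^(m+1)). As the values are 0, letting t tend to 0 gives c_k0 = 0. *)
Lemma expansion_unique0 (c : ser) (r : R) : convergent c -> 0 < r ->
  (forall y : 'cV[K]_n, (forall i, `|y i 0| < r%:C) ->
      (psum c y N : K^o) @[N --> \oo] --> (0 : K^o)) ->
  forall k, c k = 0.
Proof.
move=> /convergentP[s [M [s0 HM]]] r0 Hc.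
suff H m k : deg k = m -> c k = 0 by move=> k; exact: (H (deg k)).
elim/ltn_ind: m k => m IH k0 k0m.
have rC : 0 < r%:C by rewrite ltcR.
have M0 : 0 <= M := le_trans (abs_sum_ge0 c 0 (ltW s0)) (HM 0%N).
have kl l : (k0 l <= m)%N by rewrite -k0m leq_deg.
have [la Hla] := fin_all_exists (fun l => dual_points (kl l)).
pose La := \prod_l \sum_q `|la l q|.
have La0 : 0 <= La by apply: prodr_ge0 => l _; apply: sumr_ge0.
pose x (q : 'I_m.+1) : K := q.+1%:R^-1.
have x1 q : `|x q| <= 1 by rewrite normfV normr_nat invf_le1 ?ltr0n // ler1n.
pose W (k : @mindex n) := \prod_l \sum_q la l q * x q ^+ k l.
have WLa k : `|W k| <= La.
  rewrite normr_prod; apply: ler_prod => l _; rewrite normr_ge0 /=.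
  apply: le_trans (ler_norm_sum _ _ _) _; apply: ler_sum => q _.
  by rewrite normrM normrX ler_piMr // exprn_ile1.
have Wm k : deg k = m -> W k = (k == k0)%:R.
  move=> km; rewrite /W.
  under eq_bigr => l _ do rewrite Hla -?km ?leq_deg //.
  have [->|kk] := eqVneq k k0; first by rewrite big1 // => l _; rewrite eqxx.
  have [l /negbTE kl0] : exists l, k l != k0 l.
    apply/existsP; apply: contraNT kk => /existsPn h; apply/eqP/ffunP => l.
    by have := h l; rewrite negbK => /eqP.
  by rewrite (bigD1 l) //= kl0 mul0r.
have key t : 0 < t -> t <= 1 -> s * t < r%:C ->
   `|c k0| * (s * t) ^+ m <= La * M * t ^+ m.+1.
  move=> t0 t1 tr.
  have st0 : 0 < s * t by rewrite mulr_gt0.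
  pose y (q : {ffun 'I_n -> 'I_m.+1}) : 'cV[K]_n := \col_l (s * t * x (q l)).
  pose S N := \sum_(q : {ffun 'I_n -> 'I_m.+1}) (\prod_l la l (q l)) * psum c (y q) N.
  have SE N : S N = \sum_(k <- boxes n N) c k * (s * t) ^+ deg k * W k.
    rewrite /S; under eq_bigr do rewrite psumE mulr_sumr.
    rewrite exchange_big; apply: eq_bigr => k _ /=.
    rewrite /W bigA_distr_bigA mulr_sumr; apply: eq_bigr => q _ /=.
    have -> : mono (fun l => y q l 0) k = (s * t) ^+ deg k * \prod_l x (q l) ^+ k l.
      rewrite /deg -prodrXr -big_split /=; apply: eq_bigr => l _.
      by rewrite mxE exprMn.
    by rewrite big_split /=; ring.
  have cS : (S N : K^o) @[N --> \oo] --> (0 : K^o).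
    have -> : 0 = \sum_(q : {ffun 'I_n -> 'I_m.+1}) (\prod_l la l (q l)) * 0 :> K.
      by rewrite big1 // => q _; rewrite mulr0.
    apply: cvg_bigsum => q; apply: cvg_scale; apply: Hc => l.
    rewrite mxE normrM (gtr0_norm st0); apply: le_lt_trans tr.
    by rewrite ler_piMr // ltW.
  rewrite -subr_le0 real_leNgt ?real0 //; last first.
    by rewrite rpredB // ger0_real // ?mulr_ge0 ?exprn_ge0 // ltW.
  apply/negP => gap.
  have [N0 HN] := cvg_dist gap cS.
  pose N := maxn N0 m.+1.
  have := HN N (leq_maxl _ _); rewrite sub0r normrN.
  suff le : `|c k0| * (s * t) ^+ m <= `|S N| + La * M * t ^+ m.+1.
    by rewrite ltrBrDr => lt; have := lt_le_trans lt le; rewrite ltxx.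
  have k0N : k0 \in boxes n N by rewrite boxes_deg // k0m; exact: leq_maxr.
  have := SE N; rewrite (bigD1_seq k0) ?boxes_uniq //= k0m Wm // eqxx mulr1.
  move=> /(congr1 (fun z => z - \sum_(i <- boxes n N | i != k0) c i * (s * t) ^+ deg i * W i)).
  rewrite addrK => e.
  have -> : `|c k0| * (s * t) ^+ m = `|c k0 * (s * t) ^+ m|.
    by rewrite normrM [X in _ = _ * X]ger0_norm // exprn_ge0 // ltW.
  rewrite -e; apply: le_trans (ler_normB _ _) _; rewrite lerD2l.
  apply: le_trans (ler_norm_sum _ _ _) _.
  apply: le_trans (_ : \sum_(k <- boxes n N | k != k0) La * t ^+ m.+1 * (`|c k| * s ^+ deg k) <= _).
    apply: ler_sum => k kk0; have [km|km|km] := ltngtP (deg k) m.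
    - by rewrite (IH _ km k erefl) !mul0r normr0 mul0r mulr0.
    - rewrite !normrM exprMn normrM !normrX (gtr0_norm s0) (gtr0_norm t0).
      have -> : `|c k| * (s ^+ deg k * t ^+ deg k) * `|W k| = (`|W k| * t ^+ deg k) * (`|c k| * s ^+ deg k) by ring.
      rewrite ler_wpM2r ?mulr_ge0 ?exprn_ge0 // ?(ltW s0) //.
      apply: ler_pM => //; first by rewrite exprn_ge0 // ltW.
      by rewrite ler_wiXn2l // ltW.
    - by rewrite Wm // (negbTE kk0) mulr0 normr0 !mulr_ge0 ?exprn_ge0 // ltW.
  rewrite -mulr_sumr [La * M * _]mulrAC ler_wpM2l //.
    by rewrite mulr_ge0 // exprn_ge0 // ltW.
  apply: le_trans (HM N); rewrite /abs_sum [leRHS](bigID (fun k => k != k0)) /= lerDl.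
  by apply: sumr_ge0 => k _; rewrite mulr_ge0 // exprn_ge0 // ltW.
apply/eqP; rewrite -normr_eq0; apply: contraT => c0.
pose X := `|c k0| * s ^+ m.
have X0 : 0 < X by rewrite mulr_gt0 ?exprn_gt0 // lt_def c0 normr_ge0.
pose D := La * M + 1.
have D0 : 0 < D by rewrite ltr_wpDl // mulr_ge0.
pose t0 := r%:C / (s + r%:C).
have t00 : 0 < t0 by rewrite divr_gt0 // addr_gt0.
have t01 : t0 < 1 by rewrite ltr_pdivrMr ?addr_gt0 // mul1r ltrDr.
(* Small enough for the convergence, and such that D t < X. *)
pose t := t0 * (X / (X + D)).
have XD0 : 0 < X + D by rewrite addr_gt0.
have t_gt0 : 0 < t by rewrite mulr_gt0 // divr_gt0.
have tt0 : t <= t0.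
  by rewrite ler_piMr ?(ltW t00) // ler_pdivrMr // mul1r lerDl ltW.
have t1 : t <= 1 by rewrite (le_trans tt0) // ltW.
have st : s * t < r%:C.
  apply: le_lt_trans (ler_wpM2l (ltW s0) tt0) _.
  by rewrite mulrCA gtr_pMr // ltr_pdivrMr ?addr_gt0 // mul1r ltrDl.
have := key t t_gt0 t1 st.
rewrite exprMn mulrA -/X exprS mulrA ler_pM2r ?exprn_gt0 // => le.
have : X < X.
  apply: le_lt_trans le _; apply: (@le_lt_trans _ _ (D * t)).
    by rewrite ler_wpM2r ?(ltW t_gt0) // lerDl.
  apply: (@le_lt_trans _ _ (D * (X / (X + D)))).
    rewrite ler_wpM2l ?(ltW D0) // ler_piMl ?(ltW t01) // ltW // divr_gt0 //.
  by rewrite mulrA ltr_pdivrMr // mulrC ltr_pM2l // ltrDr.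
by rewrite ltxx.
Qed.

Lemma expands_unique p f (c c' : ser) : expands p f c -> expands p f c' -> c = c'.
Proof.
move=> [cc [r r0 H]] [cc' [r' r'0 H']]; apply/funext => k; apply/eqP.
rewrite -subr_eq0 -mulN1r addrC; apply/eqP.
apply: (@expansion_unique0 (fun k => -1 * c' k + c k) (Num.min r r')) => [||y hy].
- apply: convergentD => //; have := convergentN cc'.
  by rewrite (_ : (fun k => - c' k) = fun k => -1 * c' k) //; apply/funext => l; rewrite mulN1r.
- by rewrite lt_min r0.
rewrite (_ : (fun N => _) = fun N => -1 * psum c' y N + psum c y N); last first.
  by apply/funext => N; rewrite psumD psumZ.
rewrite (_ : 0 = -1 * f (p + y) + f (p + y)); last by rewrite mulN1r addNr.
apply: cvgD; [apply: cvg_scale; apply: H'|apply: H] => i;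
  by apply: lt_le_trans (hy i) _; rewrite lecR ge_min lexx ?orbT.
Qed.

End Expansion.

(** * The multiplicity of a sparse system *)

Section System.
Local Open Scope complex_scope.
Variables (R : realType) (n N : nat).
Local Notation K := R[i].
Local Notation O := (@cps R n).
Local Notation C_ := (@cps_const R n).
Variables (C : 'M[K]_(n, N)).

Definition system_cps (al : 'M[K]_(N, n)) (i : 'I_n) : O :=
  \sum_j C_ (C i j) * binom_cps (fun l => al j l).

Lemma cf_system al i k :
  cf (system_cps al i) k = \sum_j C i j * binom_ser (fun l => al j l) k.
Proof. by rewrite cf_sum; apply: eq_bigr => j _; rewrite cf_constM. Qed.

Lemma cst0_system al i : cst0 (system_cps al i) = (C *m const_mx 1 : 'cV_n) i 0.
Proof.
rewrite /cst0 cf_system mxE; apply: eq_bigr => j _; rewrite mxE; congr (_ * _).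
by rewrite /binom_ser big1 // => l _; rewrite ffunE /gbinom big_ord0.
Qed.

Lemma jac_system al : jac (system_cps al) = C *m al.
Proof.
apply/matrixP => i l; rewrite !mxE cf_system; apply: eq_bigr => j _; congr (_ * _).
rewrite /binom_ser (bigD1 l) //= big1 => [|k /negbTE kl].
  by rewrite ffunE eqxx mulr1 /gbinom big_ord1 subr0 divr1.
by rewrite ffunE kl /gbinom big_ord0.
Qed.

Lemma expands_system (a : 'I_N -> 'cV[R]_n) i :
  expands (const_mx 1) (sparse_system C a i)
    (cf (system_cps (\matrix_(j, l) (a j l 0)%:C) i)).
Proof.
have := expands_sum (index_enum 'I_N) (C i) (fun j => expands_monomial (a j)).
congr expands; apply/funext => k; rewrite cf_system; apply: eq_bigr => j _.
by congr (_ * _); apply: eq_bigr => l _; rewrite mxE.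
Qed.

Lemma sparse_system1 (a : 'I_N -> 'cV[R]_n) i :
  sparse_system C a i (const_mx 1) = (C *m const_mx 1 : 'cV_n) i 0.
Proof.
rewrite mxE; apply: eq_bigr => j _; rewrite mxE; congr (_ * _).
rewrite /monomial big1 // => l _; rewrite mxE clog1 mulr0.
by rewrite /cexp /= expR0 cos0 sin0 mulr0 mulr1.
Qed.

Lemma solution_system (a : 'I_N -> 'cV[R]_n) m :
  solution_of_multiplicity (sparse_system C a) (const_mx 1) m <->
  C *m (const_mx 1 : 'cV_N) = 0 /\
  quotient_dim (fun i => cf (system_cps (\matrix_(j, l) (a j l 0)%:C) i)) m.
Proof.
split=> [[H [F [HF q]]]|[H q]].
  split; first by apply/colP => i; rewrite -(sparse_system1 a) H mxE.
  have <- // : F = (fun i => cf (system_cps (\matrix_(j, l) (a j l 0)%:C) i)).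
  by apply/funext => i; apply: expands_unique (HF i) (expands_system a i).
split=> [i|]; first by rewrite sparse_system1 H mxE.
by eexists; split=> [i|]; [exact: expands_system|exact: q].
Qed.

Variable al : 'M[K]_(N, n).

Definition affine_fun (x : 'I_N -> K) :=
  exists (z : 'cV[K]_n) c, forall j, x j = (al *m z) j 0 + c.

Lemma affine_const c : affine_fun (fun=> c).
Proof. by exists 0, c => j; rewrite mulmx0 mxE add0r. Qed.

Lemma affine_comb (I : Type) (s : seq I) (P : pred I) (b : I -> K) (x : I -> 'I_N -> K) :
  (forall i, P i -> affine_fun (x i)) -> affine_fun (fun j => \sum_(i <- s | P i) b i * x i j).
Proof.
move=> H; elim: s => [|i s [z [c e]]].
  by exists 0, 0 => j; rewrite big_nil mulmx0 mxE addr0.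
case Pi : (P i); last by exists z, c => j; rewrite big_cons Pi e.
have [z' [c' e']] := H i Pi; exists (b i *: z' + z), (b i * c' + c) => j.
by rewrite big_cons Pi e e' mulmxDr -scalemxAr !mxE; ring.
Qed.

Hypothesis C1 : C *m (const_mx 1 : 'cV_N) = 0.
Variable d : 'cV[K]_N.
Hypothesis Cd : C *m d = 0.
Hypothesis d_nonconst : forall c, d != const_mx c.

Definition dpow k : 'cV[K]_N := \col_j d j 0 ^+ k.

Variable m : nat.
Hypothesis m1 : (1 < m)%N.
Hypothesis aff : forall k, (0 < k < m)%N -> affine_fun (fun j => d j 0 ^+ k).

(** The equation becomes u sum_j c_ij (1 + d_j t) plus the term of degree m,
    and the first sum vanishes because C kills d and the vector with all
    entries 1. *)
Lemma system_curve : exists (y : 'I_n -> {poly K}) (z : 'cV[K]_n) (c e : K),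
  [/\ forall l, (y l)`_0 = 0, forall l, (y l)`_1 = z l 0,
      d = al *m z + const_mx c, e != 0 &
   forall i, eqX m.+1 (ceval y m.+1 (system_cps al i))
                      ((e *: (C *m dpow m)) i 0 *: 'X^m)].
Proof.
have [zc Hzc] : exists zc : nat -> 'cV[K]_n * K, forall k, (0 < k < m)%N ->
    forall j, d j 0 ^+ k = (al *m (zc k).1) j 0 + (zc k).2.
  have H k : exists zc : 'cV[K]_n * K, (0 < k < m)%N ->
      forall j, d j 0 ^+ k = (al *m zc.1) j 0 + zc.2.
    have [km|//] := boolP (0 < k < m)%N; last by exists (0, 0).
    by have [z [c e]] := aff km; exists (z, c).
  by have [f Hf] := choice H; exists f.
have [|y [u [y0 y1 u0 Hy]]] := @curve_exists _ n 'I_N m (fun j l => al j l) (fun j => d j 0)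
  (fun k l => (zc k).1 l 0) (fun k => (zc k).2) m1.
  by move=> k j km; rewrite Hzc // mxE.
exists y, (zc 1%N).1, (zc 1%N).2, ((-1) ^+ m / m%:R); split=> //.
- apply/colP => j; rewrite [RHS]mxE [X in _ + X]mxE -[LHS]expr1 Hzc //.
- by rewrite mulf_neq0 ?signr_eq0 // invr_eq0 pnatr_eq0 -lt0n ltnW.
move=> i; rewrite /system_cps ceval_sum.
apply: eqX_trans (_ : eqX m.+1 (\sum_j C i j *:
  (u * (1 + d j 0 *: 'X) + ((-1) ^+ m / m%:R * d j 0 ^+ m) *: 'X^m)) _).
  by apply: eqX_sum => j _; rewrite ceval_constM ceval_binom; apply: eqXZ; exact: Hy.
suff -> : \sum_j C i j *:
  (u * (1 + d j 0 *: 'X) + ((-1) ^+ m / m%:R * d j 0 ^+ m) *: 'X^m) =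
   u * ((C *m (const_mx 1 : 'cV_N)) i 0)%:P + u * ((C *m d) i 0)%:P * 'X +
   (((-1) ^+ m / m%:R) *: (C *m dpow m)) i 0 *: 'X^m.
  by rewrite C1 Cd !mxE polyC0 !mulr0 mul0r !add0r; exact: eqX_refl.
rewrite !mxE !rmorph_sum !mulr_sumr !mulr_suml scaler_suml -!big_split.
apply: eq_bigr => j _ /=; rewrite !mxE -!mul_polyC !rmorphM /= ; ring.
Qed.

Lemma choose_form (z : 'cV[K]_n) c : d = al *m z + const_mx c -> 
  exists om : 'rV[K]_n, \sum_l om 0 l * z l 0 != 0.
Proof.
move=> dE; have [l zl] : exists l, z l 0 != 0.
  apply/existsP; apply: contraT => /existsPn h; have := d_nonconst c.
  rewrite dE; have -> : z = 0 by apply/colP => l; rewrite mxE; apply/eqP; have := h l; rewrite negbK.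
  by rewrite mulmx0 add0r eqxx.
exists (delta_mx 0 l); rewrite (bigD1 l) //= big1 => [|k /negbTE kl].
  by rewrite mxE !eqxx mul1r addr0.
by rewrite mxE kl andbF mul0r.
Qed.

Lemma system_indep : exists t : 'I_m -> O, indep (system_cps al) t.
Proof.
have [y [z [c [e [y0 y1 dE e0 Fy]]]]] := system_curve.
have [om omz] := choose_form dE.
exists (@pow R n (linform om) m); apply: (indep_pow m1 y0 Fy).
by under eq_bigr do rewrite y1.
Qed.

Hypothesis C_free : row_free C.
Hypothesis orth : forall c : 'rV[K]_N, c *m (const_mx 1 : 'cV_N) = 0 -> c *m al = 0 ->
  c *m dpow m = 0 -> c = 0.

(** It remains to produce the data required by [spans_w]. A row be with be J =
    0 exists because J is singular. If be C were orthogonal to d^m, it would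
    be orthogonal to all affine vectors and to d^m, hence zero. If a row u
    kills J + ka om, multiplying by the direction z of the curve shows that u
    ka = 0, since J z = 0 and om z <> 0; then u J = 0, and u C vanishes by the
    same orthogonality. *)
Lemma system_quotient_dim : quotient_dim (fun i => cf (system_cps al i)) m.
Proof.
have [y [z [c [e [y0 y1 dE e0 Fy]]]]] := system_curve.
have [om omz] := choose_form dE.
have omy : \sum_l om 0 l * (y l)`_1 != 0 by under eq_bigr do rewrite y1.
have F0 i : cst0 (system_cps al i) = 0 by rewrite cst0_system C1 mxE.
have C0 (b : 'rV_n) : b *m C = 0 -> b = 0.
  by move=> bC; apply: (row_free_inj C_free); rewrite bC mul0mx.
have Jz : C *m al *m z = 0.
  rewrite -mulmxA; have -> : al *m z = d - const_mx c by rewrite dE addrK.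
  have -> : const_mx c = c *: const_mx 1 :> 'cV[K]_N by apply/colP => j; rewrite !mxE mulr1.
  by rewrite mulmxBr Cd -scalemxAr C1 scaler0 subrr.
have z0 : z != 0.
  by apply: contraNneq omz => ->; rewrite big1 // => l _; rewrite mxE mulr0.
have omz' : om *m z != 0.
  apply: contraNneq omz => /(congr1 (fun A : 'M[K]_1 => A 0 0)); rewrite !mxE => h.
  by rewrite h.
have [be be0 beJ] : exists2 be : 'rV[K]_n, be != 0 & be *m (C *m al) = 0.
  have : kermx (C *m al) != 0.
    rewrite kermx_eq0 row_free_unit; apply: contra z0 => Ju.
    by rewrite -(mulKmx Ju z) Jz mulmx0.
  by case/rowV0Pn => be /sub_kermxP h b0; exists be.
have beka : (be *m (e *: (C *m dpow m))) 0 0 != 0.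
  apply: contra be0 => /eqP h; apply/eqP/C0/orth.
  - by rewrite -mulmxA C1 mulmx0.
  - by rewrite -mulmxA.
  apply/matrixP => i j; rewrite !ord1 [RHS]mxE; move: h.
  by rewrite -scalemxAr mxE mulmxA => /eqP; rewrite mulf_eq0 (negbTE e0) => /eqP.
have Ju : jac (system_cps al) + (e *: (C *m dpow m)) *m om \in unitmx.
  rewrite jac_system -row_free_unit -kermx_eq0; apply/eqP/row_matrixP => i.
  rewrite row0; set u := row i _.
  have : u *m (C *m al + e *: (C *m dpow m) *m om) = 0.
    by apply/sub_kermxP; exact: row_sub.
  rewrite mulmxDr => uJ.
  have := congr1 (mulmx^~ z) uJ; rewrite mul0mx mulmxDl -[u *m _ *m z]mulmxA Jz mulmx0 add0r.
  move=> uz; have sz : u *m (e *: (C *m dpow m)) *m (om *m z) = 0.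
    by rewrite -uz !mulmxA.
  have s0 : u *m (e *: (C *m dpow m)) = 0.
    apply/matrixP => a b; rewrite !ord1 [RHS]mxE; apply/eqP.
    have := congr1 (fun A : 'M[K]_1 => A 0 0) sz; rewrite mxE big_ord1 [X in _ = X]mxE.
    move/eqP; rewrite mulf_eq0 => /orP[//|/eqP h]; case/eqP: omz'.
    by apply/matrixP => a' b'; rewrite !ord1 h mxE.
  rewrite [X in _ + X]mulmxA s0 mul0mx addr0 mulmxA in uJ.
  apply/C0/orth => //; first by rewrite -mulmxA C1 mulmx0.
  move: s0; rewrite -scalemxAr mulmxA => /eqP; rewrite scaler_eq0 (negbTE e0) => /eqP //.
apply/quotient_dimE; exists (@pow R n (linform om) m); split; last first.
  exact: (indep_pow m1 y0 Fy).
by apply: (spans_w m1 y0 Fy omy F0 Ju _ beka); rewrite jac_system.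
Qed.

End System.

Section Main.
Local Open Scope complex_scope.
Variables (R : realType) (n : nat) (a : 'I_n.+2 -> 'cV[R]_n).
Local Notation K := R[i].
Local Notation O := (@cps R n).
Local Notation C_ := (@cps_const R n).
Hypothesis a_inj : injective a.
Hypothesis a_dim : ~ in_hyperplane a.
Variable C : 'M[K]_(n, n.+2).
Hypothesis C_rank : \rank C = n.

Let al : 'M[K]_(n.+2, n) := \matrix_(j, l) (a j l 0)%:C.

Lemma n_gt0 : (0 < n)%N.
Proof.
case: n a a_inj => // b /(_ ord0 ord_max) H.
have : b ord0 = b ord_max by apply/colP => -[].
by move/H.
Qed.

(** The exponents are real but z is complex: the real and imaginary parts of z
    each define a real hyperplane. *)
Lemma not_affinely_dependent (z : 'cV[K]_n) c : al *m z = const_mx c -> z = 0.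
Proof.
have real_part (f : {additive K -> R}) : (forall (x : R) (w : K), f (x%:C * w) = x * f w) ->
    al *m z = const_mx c -> forall l, f (z l 0) = 0.
  move=> fZ h l; pose u : 'rV[R]_n := \row_l f (z l 0).
  have [u0|u0] := eqVneq u 0.
    by have := congr1 (fun A : 'rV_n => A 0 l) u0; rewrite !mxE.
  case: a_dim; exists u, (f c); split=> // j.
  have := congr1 (fun A : 'cV_n.+2 => f (A j 0)) h; rewrite !mxE raddf_sum => <-.
  by apply: eq_bigr => k _; rewrite !mxE fZ mulrC.
move=> h; apply/colP => l; rewrite mxE; apply/eqP; rewrite eq_complex /=; apply/andP.
by split; apply/eqP; apply: (real_part _ _ h) => x [p q] /=; rewrite ?mul0r ?subr0 ?addr0.
Qed.

(** The affine vectors form a space of dimension n + 1, so together with a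
    vector that is not affine they span the whole space. *)
Lemma affine_orth (x : 'cV[K]_n.+2) : ~ affine_fun al (fun j => x j 0) ->
  forall c : 'rV[K]_n.+2, c *m (const_mx 1 : 'cV_n.+2) = 0 -> c *m al = 0 -> c *m x = 0 -> c = 0.
Proof.
move=> xna c c1 cal cx.
pose B := row_mx x (row_mx (const_mx 1 : 'cV_n.+2) al).
have cB : c *m B = 0 by rewrite !mul_mx_row cx c1 cal !row_mx0.
suff Bt : row_free B^T.
  have Bf : row_free B by rewrite -row_leq_rank -mxrank_tr (eqP Bt).
  by apply: (row_free_inj Bf); rewrite cB mul0mx.
rewrite -kermx_eq0; apply/eqP/row_matrixP => i.
rewrite row0; set u := row i _.
have : u *m B^T = 0 by apply/sub_kermxP; exact: row_sub.
move=> /(congr1 trmx); rewrite trmx_mul trmxK trmx0.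
set s := usubmx u^T; set t := usubmx (dsubmx u^T); set z := dsubmx (dsubmx u^T).
have uE : u^T = col_mx s (col_mx t z) by rewrite !vsubmxK.
rewrite uE !mul_row_col => e.
have ej j : x j 0 * s 0 0 + (t 0 0 + (al *m z) j 0) = 0.
  have := congr1 (fun A : 'cV_n.+2 => A j 0) e.
  rewrite mxE [(x *m s) _ _]mxE big_ord1 [(_ + al *m z) _ _]mxE.
  rewrite [(const_mx 1 *m t) _ _]mxE big_ord1 [const_mx 1 _ _]mxE mul1r.
  by rewrite [X in _ = X]mxE.
have s0 : s 0 0 = 0.
  apply/eqP; apply: contraT => s0; case: xna; exists ((- (s 0 0)^-1) *: z), (- (s 0 0)^-1 * t 0 0) => j.
  rewrite -scalemxAr mxE.
  have -> : x j 0 = (- (t 0 0 + (al *m z) j 0)) / s 0 0.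
    by rewrite -(addr0_eq (ej j)) opprK mulfK.
  ring.
have z0 : z = 0.
  apply: (@not_affinely_dependent _ (- t 0 0)); apply/colP => j; rewrite [RHS]mxE.
  by have := ej j; rewrite s0 mulr0 add0r => /addr0_eq.
have t0 : t 0 0 = 0 by have := ej ord0; rewrite s0 mulr0 add0r z0 mulmx0 [X in _ + X]mxE addr0.
apply: trmx_inj; rewrite uE trmx0 z0.
have -> : s = 0 by apply/matrixP => p q; rewrite !ord1 s0 mxE.
have -> : t = 0 by apply/matrixP => p q; rewrite !ord1 t0 mxE.
by rewrite !col_mx0.
Qed.

Let C_free : row_free C. Proof. by rewrite /row_free C_rank. Qed.

Lemma poly_vanish_distinct (d : 'cV[K]_n.+2) : injective (fun j => d j 0) ->
  forall p : {poly K}, (size p <= n.+2)%N -> (forall j, p.[d j 0] = 0) -> p = 0.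
Proof.
move=> dinj p sp p0; apply/eqP; apply: contraT => pn0.
have := max_poly_roots pn0 (rs := [seq d j 0 | j <- enum 'I_n.+2]).
rewrite size_map size_enum_ord map_inj_uniq ?enum_uniq // => /(_ _ isT) H.
suff : (n.+2 < size p)%N by rewrite ltnNge sp.
apply: H; apply/allP => x /mapP[j _ ->]; exact/rootP.
Qed.

(** Inverting the affine transformation shows that d, ..., d^n are affine. If
    d^(n+1) were affine too, a polynomial of degree n + 1 would vanish at the
    n + 2 points d_j. *)
Lemma cyclic_quotient_dim (d : 'cV[K]_n.+2) :
  C *m (const_mx 1 : 'cV_n.+2) = 0 -> C *m d = 0 ->
  injective (fun j => d j 0) -> cyclic_up_to_affine a (fun j => d j 0) ->
  quotient_dim (fun i => cf (system_cps C al i)) n.+1.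
Proof.
move=> C1 Cd dinj [M [b [Mu aE]]].
have alE j l : al j l = (M *m gamma n (d j 0) + b) l 0 by rewrite -aE !mxE.
have aff k : (0 < k < n.+1)%N -> affine_fun al (fun j => d j 0 ^+ k).
  case: k => // k kn; pose k' : 'I_n := Ordinal (kn : (k < n)%N).
  pose r := row k' (invmx M).
  exists r^T, (- (r *m b) 0 0) => j.
  have -> : (al *m r^T) j 0 = (r *m (M *m gamma n (d j 0) + b)) 0 0.
    by rewrite !mxE; apply: eq_bigr => l _; rewrite alE [r^T _ _]mxE mulrC.
  rewrite mulmxDr [X in _ = X + _]mxE addrK mulmxA /r -row_mul mulVmx // row1.
  by rewrite -rowE !mxE.
have naff : ~ affine_fun al (fun j => dpow d n.+1 j 0).
  move=> [z [c E]]; pose r := z^T *m M; pose c' := (z^T *m b) 0 0 + c.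
  pose Q : {poly K} := \sum_k r 0 k *: 'X^(k.+1) + c'%:P.
  have sQ : (size Q <= n.+1)%N.
    apply: leq_trans (size_polyD _ _) _.
    rewrite geq_max (leq_trans (size_polyC_leq1 _)) // andbT.
    apply: leq_trans (size_sum _ _ _) _; apply/bigmax_leqP => k _.
    by apply: leq_trans (size_scale_leq _ _) _; rewrite size_polyXn ltnS.
  have := @poly_vanish_distinct d dinj ('X^(n.+1) - Q).
  have sp : (size ('X^(n.+1) - Q)%R <= n.+2)%N.
    apply: leq_trans (size_polyD _ _) _.
    by rewrite size_polyXn size_polyN geq_max leqnn (leq_trans sQ).
  move=> /(_ sp) H.
  have /(congr1 (fun p : {poly K} => p`_n.+1)) : 'X^(n.+1) - Q = 0.
    apply: H => j; rewrite hornerD hornerN hornerXn.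
    have := E j; rewrite mxE => ->; apply/eqP; rewrite subr_eq0; apply/eqP.
    rewrite hornerD hornerC horner_sum /c' addrA; congr (_ + _).
    have -> : (al *m z) j 0 = (z^T *m (M *m gamma n (d j 0) + b)) 0 0.
      by rewrite !mxE; apply: eq_bigr => l _; rewrite alE [z^T _ _]mxE mulrC.
    rewrite mulmxDr [LHS]mxE mulmxA -/r; congr (_ + _).
    by rewrite mxE; apply: eq_bigr => k _; rewrite hornerZ hornerXn [X in _ * X = _]mxE.
  rewrite coefB coefXn eqxx (nth_default _ sQ) subr0 coef0 => /eqP.
  by rewrite oner_eq0.
have nc c : d != const_mx c.
  apply/eqP => e; have : ord0 = ord_max :> 'I_n.+2 by apply: dinj; rewrite e !mxE.
  by [].
apply: (system_quotient_dim C1 Cd nc _ aff) => //; first exact: n_gt0.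
by apply: affine_orth.
Qed.

(** If the Jacobian matrix were invertible, the series 1 would span the
    quotient; but n + 1 > 1. *)
Lemma quotient_dim_jac : C *m (const_mx 1 : 'cV_n.+2) = 0 ->
  quotient_dim (fun i => cf (system_cps C al i)) n.+1 -> C *m al \notin unitmx.
Proof.
move=> C1 /quotient_dimE[t [_ ti]]; apply/negP => Ju.
have F0 i : cst0 (system_cps C al i) = 0 by rewrite cst0_system C1 mxE.
have varI := nakayama F0 _; rewrite jac_system in varI.
have maxI := inI_max (varI Ju).
(* A basis of powers of w = 0, reduced to w^0 = 1. *)
have sp : spans (system_cps C al) (@pow R n 0 1).
  apply: spans_pow => [h|]; last by rewrite expr1; exact: inI0.
  by exists 0; rewrite mul0r subr0.
have := indep_le_spans ti sp; rewrite ltnS leqn0 => /eqP n0.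
by have := n_gt0; rewrite n0.
Qed.

(** If two of the d_j coincide, all of them are roots of a monic polynomial of
    degree n + 1, which makes d^(n+1) a combination of lower powers. *)
Lemma affine_pow_injective (d : 'cV[K]_n.+2) :
  (forall k, (k <= n)%N -> affine_fun al (fun j => d j 0 ^+ k)) ->
  ~ affine_fun al (fun j => d j 0 ^+ n.+1) -> injective (fun j => d j 0).
Proof.
move=> aff naff i1 i2 e12; apply/eqP; apply: contraT => ne; case: naff.
pose q := \prod_(k <- enum (predC1 i1)) ('X - (d k 0)%:P).
have qroot j : q.[d j 0] = 0.
  have [k ki kj] : exists2 k, k != i1 & d k 0 = d j 0.
    have [->|ji] := eqVneq j i1; last by exists j.
    by exists i2; rewrite 1?eq_sym.
  rewrite horner_prod (bigD1_seq k) ?mem_enum ?enum_uniq //=.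
  by rewrite hornerXsubC kj subrr mul0r.
have qm : q \is monic by apply: monic_prod_XsubC.
have sq : size q = n.+2.
  by rewrite size_prod_XsubC -cardE cardC1 card_ord.
have E j : d j 0 ^+ n.+1 = \sum_(k < n.+1) (- q`_k) * d j 0 ^+ k.
  have := qroot j; rewrite horner_coef sq big_ord_recr /=.
  have -> : q`_n.+1 = 1 by move/monicP: qm; rewrite /lead_coef sq.
  rewrite mul1r => /addr0_eq <-; rewrite -sumrN; apply: eq_bigr => k _.
  by rewrite mulNr.
have [z [c H]] := @affine_comb _ _ _ al _ (index_enum 'I_n.+1) xpredT (fun k => - q`_k)
   (fun k j => d j 0 ^+ k) (fun k _ => aff k (ltn_ord k)).
by exists z, c => j; rewrite E H.
Qed.

(** The affine map sends a_j to gamma (d_j). A row that kills its linear part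
    would give a non-zero polynomial of degree at most n that vanishes at the
    n + 2 points d_j. *)
Lemma affine_pow_cyclic (d : 'cV[K]_n.+2) :
  (forall k, (k <= n)%N -> affine_fun al (fun j => d j 0 ^+ k)) ->
  injective (fun j => d j 0) -> cyclic_up_to_affine a (fun j => d j 0).
Proof.
move=> aff dinj.
have [z Hz] := fin_all_exists (fun k : 'I_n => aff k.+1 (ltn_ord k)).
have [c Hc] := fin_all_exists Hz.
pose Z : 'M[K]_n := \matrix_(k, l) z k l 0; pose cc : 'cV[K]_n := \col_k c k.
have ZE j : gamma n (d j 0) = Z *m map_mx (real_complex R) (a j) + cc.
  apply/colP => k; rewrite !mxE Hc mxE; congr (_ + _).
  by apply: eq_bigr => l _; rewrite !mxE mulrC.
have Zu : Z \in unitmx.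
  rewrite -row_free_unit -kermx_eq0; apply/eqP/row_matrixP => i.
  rewrite row0; set u := row i _.
  have uZ : u *m Z = 0 by apply/sub_kermxP; exact: row_sub.
  pose p : {poly K} := \sum_k u 0 k *: 'X^(k.+1) - ((u *m cc) 0 0)%:P.
  have p0 : p = 0.
    apply: (poly_vanish_distinct dinj) => [|j].
      apply: leq_trans (size_polyD _ _) _.
      rewrite size_polyN geq_max (leq_trans (size_polyC_leq1 _)) // andbT.
      apply: leq_trans (size_sum _ _ _) _; apply/bigmax_leqP => k _.
      apply: leq_trans (size_scale_leq _ _) _; rewrite size_polyXn.
      by rewrite !ltnS ltnW.
    rewrite hornerD hornerN hornerC horner_sum; apply/eqP; rewrite subr_eq0; apply/eqP.
    have := congr1 (mulmx u) (ZE j); rewrite mulmxDr mulmxA uZ mul0mx add0r => <-.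
    by rewrite mxE; apply: eq_bigr => k _; rewrite hornerZ hornerXn [X in _ = _ * X]mxE.
  apply/rowP => k; rewrite [RHS]mxE.
  have := congr1 (fun p : {poly K} => p`_k.+1) p0.
  rewrite coefB coefC subr0 coef0 coef_sum (bigD1 k) //= coefZ coefXn eqxx mulr1.
  rewrite big1 ?addr0 // => l /negbTE lk.
  by rewrite coefZ coefXn eqSS eq_sym val_eqE lk mulr0.
exists (invmx Z), (- (invmx Z *m cc)); split=> [|j]; first by rewrite unitmx_inv.
by rewrite ZE mulmxDr mulKmx // addrK.
Qed.

(** Let m be the least exponent for which d^m is not affine. It exists and is
    at most n + 1, as otherwise n + 2 elements would be independent in the
    quotient ([system_indep]); and the quotient has dimension m. *)
Lemma quotient_dim_cyclic :
  C *m (const_mx 1 : 'cV_n.+2) = 0 ->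
  quotient_dim (fun i => cf (system_cps C al i)) n.+1 ->
  exists d : 'cV[K]_n.+2, C *m d = 0 /\ injective (fun j => d j 0) /\
    cyclic_up_to_affine a (fun j => d j 0).
Proof.
move=> C1 qd; have Jn := quotient_dim_jac C1 qd.
have [v v0 Jv] : exists2 v : 'cV[K]_n, v != 0 & C *m al *m v = 0.
  have : kermx (C *m al)^T != 0 by rewrite kermx_eq0 row_free_unit unitmx_tr.
  case/rowV0Pn => w /sub_kermxP h w0; exists w^T.
    by apply: contra w0 => /eqP/(congr1 trmx); rewrite trmxK trmx0 => ->.
  by rewrite -[C *m al]trmxK -trmx_mul h trmx0.
pose d := al *m v; exists d.
have Cd : C *m d = 0 by rewrite mulmxA.
have nc c : d != const_mx c.
  by apply: contra v0 => /eqP/not_affinely_dependent ->.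
have aff1 : affine_fun al (fun j => d j 0 ^+ 1) by exists v, 0 => j; rewrite addr0 expr1.
have aff0 : affine_fun al (fun j => d j 0 ^+ 0).
  by have [z [c H]] := affine_const al 1; exists z, c => j; rewrite expr0 -H.
move/quotient_dimE: (qd) => [t [ts ti]].
have ex : exists k, `[< (k <= n.+1)%N /\ ~ affine_fun al (fun j => d j 0 ^+ k) >].
  apply: contrapT => nex.
  have aff k : (0 < k < n.+2)%N -> affine_fun al (fun j => d j 0 ^+ k).
    move=> /andP[_ kn]; apply: contrapT => naff; apply: nex.
    by exists k; apply/asboolP.
  have [t' ti'] := system_indep C1 Cd nc (isT : (1 < n.+2)%N) aff.
  by have := indep_le_spans ti' ts; rewrite ltnn.
case: (ex_minnP ex) => m /asboolP[mn naff] mmin.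
have aff k : (k < m)%N -> affine_fun al (fun j => d j 0 ^+ k).
  move=> km; apply: contrapT => nk; have : (m <= k)%N; last by rewrite leqNgt km.
  by apply: mmin; apply/asboolP; split=> //; exact: leq_trans (ltnW km) mn.
have m1 : (1 < m)%N by case: m naff {mn mmin aff} => [|[|]].
have naff' : ~ affine_fun al (fun j => dpow d m j 0).
  by move=> [z [c H]]; apply: naff; exists z, c => j; rewrite -H [RHS]mxE.
have /quotient_dimE[t' [ts' _]] := system_quotient_dim C1 Cd nc m1
  (fun k km => aff k (proj2 (andP km))) C_free (affine_orth naff').
have mE : m = n.+1 by apply/eqP; rewrite eqn_leq mn (indep_le_spans ti ts').
rewrite mE in aff naff.
have dinj := affine_pow_injective aff naff.
by split=> //; split=> //; exact: affine_pow_cyclic.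
Qed.

End Main.

Theorem theorem8p3 (R : realType) (n : nat)
    (a : 'I_n.+2 -> 'cV[R]_n) (a_inj : injective a)
    (a_dim : ~ in_hyperplane a)
    (C : 'M[R[i]]_(n, n.+2)) (C_rank : \rank C = n) :
  solution_of_multiplicity (sparse_system C a) (const_mx 1) n.+1 <->
  C *m (const_mx 1 : 'cV_n.+2) = 0 /\
  exists d : 'cV[R[i]]_n.+2,
    C *m d = 0 /\
    injective (fun j => d j 0) /\
    cyclic_up_to_affine a (fun j => d j 0).
Proof.
apply: (iff_trans (solution_system C a n.+1)); split=> [[C1 qd]|[C1 [d [Cd [dinj cyc]]]]].
  by split=> //; exact: quotient_dim_cyclic qd.
by split=> //; exact: cyclic_quotient_dim Cd dinj cyc.
Qed.
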